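(* Let $E\to M$ be a nonzero vector bundle, $A\subset\mathcal{T}=TM\oplus E$ a nonzero projective Lie algebroid, $L^A\subset\mathcal{E}=\mathfrak{D}E\oplus\mathfrak{J}E$ its lifted Dirac structure, and let $\Omega:A\wedge A\to A\cap E$ be a bundle map. If $\mathbf{b}^*\Omega=d_{L^A}\omega_X$ for some $X\in\Gamma(\mathcal{E})$, then $X\in N_{A^0}=N_{\mathbf{b}^{-1}(A)}$. Moreover, $$(1)\qquad \Omega(a_1,a_2)=\tfrac12\big([X_\bullet a_1,a_2]_A+[a_1,X_\bullet a_2]_A-X_\bullet[a_1,a_2]_A\big),\qquad\forall\,a_1,a_2\in\Gamma(A).$$ Furthermore, $\Omega$ generates a deformation of the projective Lie algebroid $A$ if and only if $$(2)\qquad [T^X(a,b),c]_A+T^X([a,b]_A,c)+c.p.=0,\qquad\forall\,a,b,c\in\Gamma(A),$$ where $T^X:\Gamma(A)\wedge\Gamma(A)\to\Gamma(A)$ is defined by $$T^X(a,b)=X_\bullet\big([X_\bullet a,b]_A+[a,X_\bullet b]_A-X_\bullet[a,b]_A\big)-[X_\bullet a,X_\bullet b]_A .$$ Conversely, for any $X\in N_{\mathbf{b}^{-1}(A)}=N_{A^0}$ satisfying (2), the map $\Omega$ defined by (1) is a bundle map from $A\wedge A$ to $A\cap E$ that generates a deformation of $A$, and $\mathbf{b}^*\Omega=d_{L^A}\omega_X$ holds.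
   Context: Omni-Lie algebroid. $\mathfrak{D}E$ is the gauge Lie algebroid of $E$: its sections are the $\mathbb{R}$-linear operators $\mathfrak{d}:\Gamma(E)\to\Gamma(E)$ for which there is a vector field $\alpha(\mathfrak{d})$ with $\mathfrak{d}(fu)=f\mathfrak{d}u+\alpha(\mathfrak{d})(f)u$; the bracket $[\cdot,\cdot]_{\mathfrak{D}}$ is the commutator, the anchor is $\alpha:\mathfrak{D}E\to TM$, and $\ker\alpha=\mathfrak{gl}(E)$. (The same notation $\mathfrak{D}V$ is used for any vector bundle $V$.) $\mathfrak{J}E$ is the first jet bundle of $E$ with projection $\mathbf{p}:\mathfrak{J}E\to E$ and $\ker\mathbf{p}=\mathrm{Hom}(TM,E)$. For $u\in\Gamma(E)$, $\mathbf{d}u\in\Gamma(\mathfrak{J}E)$ denotes its first jet; $\mathrm{Hom}(TM,E)$ is embedded so that $\mathbf{d}(fu)=f\,\mathbf{d}u+df\otimes u$. There is a nondegenerate $C^\infty(M)$-bilinear $E$-valued pairing with $\langle\mathbf{d}u,\mathfrak{d}\rangle_E=\langle\mathfrak{d},\mathbf{d}u\rangle_E=\mathfrak{d}u$. For $\mathfrak{d}\in\Gamma(\mathfrak{D}E)$ and $\mu\in\Gamma(\mathfrak{J}E)$, the Lie derivative $\mathfrak{L}_{\mathfrak{d}}\mu\in\Gamma(\mathfrak{J}E)$ is defined by $\langle\mathfrak{L}_{\mathfrak{d}}\mu,\mathfrak{d}'\rangle_E=\mathfrak{d}\langle\mu,\mathfrak{d}'\rangle_E-\langle\mu,[\mathfrak{d},\mathfrak{d}']_{\mathfrak{D}}\rangle_E$.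 On $\mathcal{E}=\mathfrak{D}E\oplus\mathfrak{J}E$ let $\rho:\mathcal{E}\to\mathfrak{D}E$ be the projection, $$\{\mathfrak{d}+\mu,\mathfrak{r}+\nu\}=[\mathfrak{d},\mathfrak{r}]_{\mathfrak{D}}+\mathfrak{L}_{\mathfrak{d}}\nu-\mathfrak{L}_{\mathfrak{r}}\mu+\mathbf{d}\langle\mu,\mathfrak{r}\rangle_E,\qquad (\mathfrak{d}+\mu,\mathfrak{r}+\nu)_E=\tfrac12(\langle\mathfrak{d},\nu\rangle_E+\langle\mathfrak{r},\mu\rangle_E).$$ The bundle map $\mathbf{b}:\mathcal{E}\to\mathcal{T}$ is $\mathbf{b}(\mathfrak{d}+\mu)=\alpha(\mathfrak{d})+\mathbf{p}(\mu)$; its kernel is $\mathrm{Hom}(\mathcal{T},E)=\mathfrak{gl}(E)\oplus\mathrm{Hom}(TM,E)\subset\mathcal{E}$, where $\Phi+\mathfrak{y}$ acts on $x+u\in\mathcal{T}$ by $\Phi(u)+\mathfrak{y}(x)$. For a subbundle $S\subset\mathcal{E}$, $S^\perp=\{X\in\mathcal{E}: (X,s)_E=0\ \forall s\in S\}$. A Dirac structure is a subbundle $L$ that is maximal isotropic (equivalently $L=L^\perp$) with $\{\Gamma(L),\Gamma(L)\}\subset\Gamma(L)$; it is a Lie algebroid with the restricted bracket and anchor $\alpha\circ\rho$, and $\rho_L=\rho|_L:L\to\mathfrak{D}E$ is a representation of $L$ on $E$. $d_L$ is the Lie algebroid coboundary operator on $\Gamma(\mathrm{Hom}(\wedge^\bullet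 L,E))$ of this representation; on $1$-cochains $d_L\omega(l_1,l_2)=\rho_L(l_1)\omega(l_2)-\rho_L(l_2)\omega(l_1)-\omega(\{l_1,l_2\})$. $L$ is reducible if $\mathbf{b}(L)$ has constant rank. A projective Lie algebroid is a subbundle $A\subset TM\oplus E$ with a Lie algebroid structure $(A,[\cdot,\cdot]_A,\rho_A)$ whose anchor is $\rho_A=pr_{TM}|_A$. Its lifted Dirac structure $L^A$ is the unique reducible Dirac structure $L\subset\mathcal{E}$ with $\mathbf{b}(L)=A$ and $\mathbf{b}\{X,Y\}=[\mathbf{b}X,\mathbf{b}Y]_A$ for all $X,Y\in\Gamma(L)$ (it exists). $A^0=\{h\in\mathrm{Hom}(\mathcal{T},E): h(A)=0\}$, a subbundle of $\mathcal{E}$. For $X\in\Gamma(\mathcal{E})$, $\omega_X=(X,\cdot)_E:L^A\to E$, and $(\mathbf{b}^*\Omega)(l_1,l_2)=\Omega(\mathbf{b}l_1,\mathbf{b}l_2)$ for $l_1,l_2\in L^A$. The normalizer of a subbundle $C\subset\mathcal{E}$ is $N_C=\{X\in\Gamma(\mathcal{E}): \{X,Y\}\in\Gamma(C)\ \forall\, Y\in\Gamma(C)\}$. The falling operator $(\cdot)_\bullet:\Gamma(\mathcal{E})\to\Gamma(\mathfrak{D}\mathcal{T})$ is $X_\bullet(t)=\mathbf{b}\{X,Y\}$ for $t\in\Gamma(\mathcal{T})$ and any $Y\in\Gamma(\mathcal{E})$ with $\mathbf{b}(Y)=t$ (well defined); for $X\in N_{\mathbf{b}^{-1}(A)}$ it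 maps $\Gamma(A)$ to $\Gamma(A)$. A bundle map $\Omega:A\wedge A\to A\cap E$ generates a deformation of the projective Lie algebroid $A$ if for every parameter $\varepsilon$ the bracket $[a,b]_A^\varepsilon=[a,b]_A+\varepsilon\,\Omega(a,b)$ makes $A$ (with anchor $pr_{TM}|_A$) a projective Lie algebroid. ''$+c.p.$'' means adding the cyclic permutations in $a,b,c$ of all preceding terms. *)

(* Defs.v *)
From HB Require Import structures.
From mathcomp Require Import all_boot all_order all_algebra.
From mathcomp Require Import all_classical all_reals all_analysis.
From mathcomp Require Import ring.

Set Implicit Arguments.
Unset Strict Implicit.
Unset Printing Implicit Defensive.

Import Order.TTheory GRing.Theory Num.Theory numFieldNormedType.Exports.
Local Open Scope classical_set_scope.
Local Open Scope ring_scope.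

Section EuclideanSmooth.
Variables (R : realType) (n : nat).
Implicit Types (U : set 'rV[R]_n) (f g : 'rV[R]_n -> R).

Fixpoint Ck (k : nat) U f : Prop :=
  match k with
  | 0%N => forall p, U p -> {for p, continuous f}
  | k'.+1 => (forall p, U p -> differentiable f p) /\
             (forall v, Ck k' U (fun p => 'd f p v))
  end.

Definition smooth_on U f : Prop := forall k, Ck k U f.

Lemma near_diff f g (p : 'rV[R]_n) :
  (\forall q \near p, f q = g q) -> differentiable f p ->
  differentiable g p /\ ('d g p : _ -> R) = 'd f p.
Proof.
move=> fg df; have [cdf] := (diff_locallyP p f).1 df.
move=> eqf.
have eqg : g \o shift p = cst (g p) + 'd f p +o_ (0 : 'rV[R]_n) id.
  apply/eqaddoP => e e0; move/eqaddoP : eqf => /(_ e e0) eqf.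
  have fg0 : \forall h \near (0 : 'rV[R]_n), f (h + p) = g (h + p).
    have : (fun h : 'rV[R]_n => h + p) @ (0 : 'rV[R]_n) --> p.
      rewrite -[X in _ --> X]add0r.
      by apply: (@cvgD _ _ _ (nbhs (0 : 'rV[R]_n)) _ id (cst p)); [exact: cvg_id|exact: cvg_cst].
    by move=> /(_ _ fg).
  have fgp := nbhs_singleton fg.
  apply: filterS2 fg0 eqf => h /= fgh.
  by rewrite !fctE /= fgh fgp.
have dg := diff_unique cdf eqg.
split; last exact: dg.
apply/(diff_locallyP p g); split.
  by rewrite dg; exact: cdf.
by rewrite dg; exact: eqg.
Qed.

Lemma Ck_ext k U f g : open U -> (forall p, U p -> f p = g p) ->
  Ck k U f -> Ck k U g.
Proof.
move=> oU; have nU p : U p -> nbhs p U by move=> Up; apply: open_nbhs_nbhs.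
elim: k f g => [|k IH] f g fg /=.
  move=> cf p Up; change (g @ p --> g p); rewrite -(fg p Up).
  apply: cvg_trans (cf p Up); apply: (@near_eq_cvg _ _ (nbhs p)).
  by apply: filterS (nU p Up) => q /fg.
move=> [df cdf].
have dd p (Up : U p) : differentiable g p /\ ('d g p : _ -> R) = 'd f p.
  by apply: near_diff; [apply: filterS (nU p Up) => q /fg|exact: df].
split=> [p Up|v]; first by have [] := dd p Up.
apply: (IH _ _ _ (cdf v)) => p Up; have [_ e] := dd p Up.
exact: (congr1 (fun h : 'rV[R]_n -> R => h v) (esym e)).
Qed.

Lemma CkS k U f : Ck k.+1 U f -> Ck k U f.
Proof.
elim: k f => [|k IH] f [df cf]; last by split=> // v; apply: IH.
by move=> p Up; apply: differentiable_continuous; exact: df.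
Qed.

Lemma Ck_cst k U (c : R) : Ck k U (fun=> c).
Proof.
elim: k c => [|k IH] c /=; first by move=> p _; exact: (@cst_continuous _ _ c p).
split=> [p _|v]; first exact: (@differentiable_cst _ _ _ c p).
have -> : (fun p => 'd (fun=> c) p v) = (fun=> 0) :> ('rV[R]_n -> R).
  by apply/funext => p; have := diff_cst c p => /(congr1 (fun h => h v)).
exact: IH.
Qed.

Lemma CkD k U f g : open U -> Ck k U f -> Ck k U g ->
  Ck k U (fun p => f p + g p).
Proof.
move=> oU; elim: k f g => [|k IH] f g /=.
  by move=> cf cg p Up; exact: (continuousD (cf p Up) (cg p Up)).
move=> [df cf] [dg cg]; split=> [p Up|v].
  by apply: differentiableD; [exact: df|exact: dg].
apply: (Ck_ext oU _ (IH _ _ (cf v) (cg v))) => p Up /=.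
exact: (congr1 (fun h : 'rV[R]_n -> R => h v) (esym (diffD (df p Up) (dg p Up)))).
Qed.

Lemma CkM k U f g : open U -> Ck k U f -> Ck k U g ->
  Ck k U (fun p => f p * g p).
Proof.
move=> oU; elim: k f g => [|k IH] f g.
  by move=> cf cg p Up; exact: (continuousM (cf p Up) (cg p Up)).
move=> Cf Cg; have [df cf] := Cf; have [dg cg] := Cg; split=> [p Up|v].
  by apply: differentiableM; [exact: df|exact: dg].
have Cf' := CkS Cf; have Cg' := CkS Cg.
apply: (Ck_ext oU _ (CkD oU (IH _ _ Cf' (cg v)) (IH _ _ Cg' (cf v)))) => p Up /=.
exact: (congr1 (fun h : 'rV[R]_n -> R => h v) (esym (diffM (df p Up) (dg p Up)))).
Qed.

End EuclideanSmooth.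

Record chart (R : realType) (T : topologicalType) (n : nat) := Chart {
  cdom : set T;
  cran : set 'rV[R]_n;
  cmap : T -> 'rV[R]_n;
  cinv : 'rV[R]_n -> T }.

Definition is_chart R T n (c : @chart R T n) : Prop :=
  [/\ open (cdom c), open (cran c),
      forall x, cdom c x -> cran c (cmap c x) /\ cinv c (cmap c x) = x,
      forall p, cran c p -> cdom c (cinv c p) /\ cmap c (cinv c p) = p &
      (forall x, cdom c x -> {for x, continuous (cmap c)}) /\
      (forall p, cran c p -> {for p, continuous (cinv c)})].

Definition chart_compat R T n (c c' : @chart R T n) : Prop :=
  forall j, smooth_on (cran c `&` cinv c @^-1` cdom c')
                      (fun p => cmap c' (cinv c p) 0 j).

Record manifold (R : realType) := Manifold {
  mcarrier :> topologicalType;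
  mdim : nat;
  matlas : set (chart R mcarrier mdim);
  m_hausdorff : hausdorff_space mcarrier;
  m_second_countable : @second_countable mcarrier;
  m_chart : forall c, matlas c -> is_chart c;
  m_cover : forall x : mcarrier, exists2 c, matlas c & cdom c x;
  m_compat : forall c c', matlas c -> matlas c' -> chart_compat c c' }.

Section SmoothFunctions.
Variables (R : realType) (M : manifold R).
Implicit Types (U : set M) (f g : M -> R).

Definition smooth_fun U f : Prop :=
  forall c, matlas c -> smooth_on (cran c `&` cinv c @^-1` U) (f \o cinv c).

Lemma open_chart_preim U (c : chart R M (mdim M)) : matlas c -> open U ->
  open (cran c `&` cinv c @^-1` U).
Proof.
move=> Mc oU; have [_ oR _ _ [_ ci]] := m_chart Mc.
rewrite openE => p [Rp Up]; rewrite /interior.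
apply: filterI; first exact: open_nbhs_nbhs.
by apply: (ci p Rp); apply: open_nbhs_nbhs.
Qed.

Lemma smooth_fun_ext U f g : open U -> (forall x, U x -> f x = g x) ->
  smooth_fun U f -> smooth_fun U g.
Proof.
move=> oU fg sf c Mc k; apply: Ck_ext (sf c Mc k).
  exact: open_chart_preim.
by move=> p [_ Up]; exact: fg.
Qed.

Lemma smooth_fun_cst U (a : R) : smooth_fun U (fun=> a).
Proof. by move=> c Mc k; exact: Ck_cst. Qed.

Lemma smooth_funD U f g : open U -> smooth_fun U f -> smooth_fun U g ->
  smooth_fun U (fun x => f x + g x).
Proof.
move=> oU sf sg c Mc k; apply: CkD (sf c Mc k) (sg c Mc k).
exact: open_chart_preim.
Qed.

Lemma smooth_funM U f g : open U -> smooth_fun U f -> smooth_fun U g ->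
  smooth_fun U (fun x => f x * g x).
Proof.
move=> oU sf sg c Mc k; apply: CkM (sf c Mc k) (sg c Mc k).
exact: open_chart_preim.
Qed.

Lemma smooth_funW U f : open U -> smooth_fun setT f -> smooth_fun U f.
Proof.
move=> oU sf c Mc k.
have sub (V W : set 'rV[R]_(mdim M)) h : V `<=` W -> forall k, Ck k W h -> Ck k V h.
  move=> VW i; elim: i h => [|i IH] h /=; first by move=> ch p /VW /ch.
  by move=> [dh ch]; split=> [p /VW /dh //|v]; exact: IH.
by apply: sub (sf c Mc k) => p [].
Qed.

Record Cinf := MkCinf { cf :> M -> R; cf_smooth : smooth_fun setT cf }.

Lemma cf_ext (f g : Cinf) : (forall x, f x = g x) -> f = g.
Proof.
case: f g => [f sf] [g sg] /= /funext fg; rewrite fg in sf *.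
by congr MkCinf; exact: Prop_irrelevance.
Qed.

Definition cst_cf (a : R) : Cinf := MkCinf (smooth_fun_cst setT a).
Definition add_cf (f g : Cinf) : Cinf :=
  MkCinf (smooth_funD openT (@cf_smooth f) (@cf_smooth g)).
Definition mul_cf (f g : Cinf) : Cinf :=
  MkCinf (smooth_funM openT (@cf_smooth f) (@cf_smooth g)).
Definition opp_cf (f : Cinf) : Cinf := mul_cf (cst_cf (-1)) f.

HB.instance Definition _ := gen_eqMixin Cinf.
HB.instance Definition _ := gen_choiceMixin Cinf.

Fact add_cfA : associative add_cf.
Proof. by move=> f g h; apply: cf_ext => x; exact: addrA. Qed.
Fact add_cfC : commutative add_cf.
Proof. by move=> f g; apply: cf_ext => x; exact: addrC. Qed.
Fact add_0cf : left_id (cst_cf 0) add_cf.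
Proof. by move=> f; apply: cf_ext => x; exact: add0r. Qed.
Fact add_Ncf : left_inverse (cst_cf 0) opp_cf add_cf.
Proof. by move=> f; apply: cf_ext => x; rewrite /= mulN1r addNr. Qed.
HB.instance Definition _ :=
  GRing.isZmodule.Build Cinf add_cfA add_cfC add_0cf add_Ncf.

Fact mul_cfA : associative mul_cf.
Proof. by move=> f g h; apply: cf_ext => x; exact: mulrA. Qed.
Fact mul_cfC : commutative mul_cf.
Proof. by move=> f g; apply: cf_ext => x; exact: mulrC. Qed.
Fact mul_1cf : left_id (cst_cf 1) mul_cf.
Proof. by move=> f; apply: cf_ext => x; exact: mul1r. Qed.
Fact mul_cfDl : left_distributive mul_cf add_cf.
Proof. by move=> f g h; apply: cf_ext => x; exact: mulrDl. Qed.
(* A possibly zero ring: the manifold may be empty. *)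
HB.instance Definition _ :=
  GRing.Zmodule_isComPzRing.Build Cinf mul_cfA mul_cfC mul_1cf mul_cfDl.

End SmoothFunctions.

Record triv (R : realType) (M : manifold R) (r : nat) (F : M -> lmodType R) :=
  Triv { tdom : set M; tmap : forall x, F x -> 'rV[R]_r }.

Definition is_triv R (M : manifold R) r (F : M -> lmodType R)
    (phi : triv r F) : Prop :=
  open (tdom phi) /\
  forall x, tdom phi x -> linear (@tmap R M r F phi x) /\
                          bijective (@tmap R M r F phi x).

Definition triv_compat R (M : manifold R) r (F : M -> lmodType R)
    (phi psi : triv r F) : Prop :=
  exists g : M -> 'M[R]_r,
    (forall i j, smooth_fun (tdom phi `&` tdom psi) (fun x => g x i j)) /\
    (forall x, tdom phi x -> tdom psi x -> forall v : F x,
       tmap psi v = tmap phi v *m g x).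

(** The fibres are given as a family of vector spaces, and the smooth structure
    by an atlas of local trivializations with smooth transition matrices.  The
    rank is constant even when [M] is not connected. *)
Record vbundle (R : realType) (M : manifold R) := VBundle {
  vrank : nat;
  fibre :> M -> lmodType R;
  vatlas : set (triv vrank fibre);
  v_triv : forall phi, vatlas phi -> is_triv phi;
  v_cover : forall x : M, exists2 phi, vatlas phi & tdom phi x;
  v_compat : forall phi psi, vatlas phi -> vatlas psi -> triv_compat phi psi }.

Section Sections.
Variables (R : realType) (M : manifold R) (E : vbundle M).

Definition smooth_section (s : forall x, E x) : Prop :=
  forall phi, vatlas phi -> forall j,
    smooth_fun (tdom phi) (fun x => tmap phi (s x) 0 j).

Record Sec := MkSec { sec :> forall x, E x; sec_smooth : smooth_section sec }.

Lemma sec_ext (s t : Sec) : (forall x, s x = t x) -> s = t.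
Proof.
case: s t => [s ss] [t st] /= h.
have e : s = t by apply: functional_extensionality_dep.
by rewrite e in ss *; congr MkSec; exact: Prop_irrelevance.
Qed.

Fact add_sec_smooth (s t : Sec) : smooth_section (fun x => s x + t x).
Proof.
move=> phi Vphi j; have [oU lin] := v_triv Vphi.
apply: (smooth_fun_ext oU _ (smooth_funD oU (@sec_smooth s phi Vphi j)
  (@sec_smooth t phi Vphi j))) => x /lin [lx _] /=.
by have := lx 1 (s x) (t x); rewrite !scale1r => ->; rewrite mxE.
Qed.
Definition add_sec s t := MkSec (add_sec_smooth s t).

Fact tmap0 (phi : triv (vrank E) E) x :
  vatlas phi -> tdom phi x -> tmap phi (0 : E x) = 0.
Proof.
move=> Vphi Ux; have [_ /(_ x Ux) [lx _]] := v_triv Vphi.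
have := lx (-1) 0 0; rewrite scaler0 addr0 => e.
by apply/eqP; rewrite -(addrN (tmap phi (0 : E x))) {1}e scaleN1r addrC subrr.
Qed.

Fact scale_sec_smooth (f : Cinf M) (s : Sec) :
  smooth_section (fun x => f x *: s x).
Proof.
move=> phi Vphi j; have [oU lin] := v_triv Vphi.
apply: (smooth_fun_ext oU _ (smooth_funM oU (smooth_funW oU (@cf_smooth R M f))
  (@sec_smooth s phi Vphi j))) => x Ux /=.
have [lx _] := lin x Ux.
by have := lx (f x) (s x) 0; rewrite !addr0 (tmap0 Vphi Ux) addr0 => ->; rewrite mxE.
Qed.
Definition scale_sec f s := MkSec (scale_sec_smooth f s).

Fact zero_sec_smooth : smooth_section (fun x => 0).
Proof.
move=> phi Vphi j; have [oU lin] := v_triv Vphi.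
apply: (smooth_fun_ext oU _ (smooth_fun_cst _ 0)) => x Ux /=.
by rewrite (tmap0 Vphi Ux) mxE.
Qed.
Definition zero_sec := MkSec zero_sec_smooth.
Definition opp_sec s := scale_sec (-1) s.

HB.instance Definition _ := gen_eqMixin Sec.
HB.instance Definition _ := gen_choiceMixin Sec.

Fact add_secA : associative add_sec.
Proof. by move=> f g h; apply: sec_ext => x; exact: addrA. Qed.
Fact add_secC : commutative add_sec.
Proof. by move=> f g; apply: sec_ext => x; exact: addrC. Qed.
Fact add_0sec : left_id zero_sec add_sec.
Proof. by move=> f; apply: sec_ext => x; exact: add0r. Qed.
Fact add_Nsec : left_inverse zero_sec opp_sec add_sec.
Proof. by move=> f; apply: sec_ext => x; rewrite /= mulr1 scaleN1r addNr. Qed.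
HB.instance Definition _ :=
  GRing.isZmodule.Build Sec add_secA add_secC add_0sec add_Nsec.

Fact scale_secA f g s : scale_sec f (scale_sec g s) = scale_sec (f * g) s.
Proof. by apply: sec_ext => x; exact: scalerA. Qed.
Fact scale_1sec : left_id 1 scale_sec.
Proof. by move=> s; apply: sec_ext => x; exact: scale1r. Qed.
Fact scale_secDr : right_distributive scale_sec +%R.
Proof. by move=> f s t; apply: sec_ext => x; exact: scalerDr. Qed.
Fact scale_secDl s : {morph scale_sec^~ s : f g / f + g}.
Proof. by move=> f g; apply: sec_ext => x; exact: scalerDl. Qed.
HB.instance Definition _ := GRing.Zmodule_isLmodule.Build (Cinf M) Sec
  scale_secA scale_1sec scale_secDr scale_secDl.

End Sections.

Section VectorFields.
Variables (R : realType) (M : manifold R).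
Local Notation C := (Cinf M).

(** Vector fields, as derivations of the algebra of smooth functions. *)
Record VF := MkVF {
  vf :> C -> C;
  vf_lin : forall (a : R) (f g : C),
    vf (cst_cf M a * f + g) = cst_cf M a * vf f + vf g;
  vf_leib : forall f g : C, vf (f * g) = f * vf g + vf f * g }.

Lemma vf_ext (X Y : VF) : (forall f, X f = Y f) -> X = Y.
Proof.
case: X Y => [X Xl XL] [Y Yl YL] /= /funext e; rewrite e in Xl XL *.
by congr MkVF; exact: Prop_irrelevance.
Qed.

Lemma vfD (X : VF) f g : X (f + g) = X f + X g.
Proof. by have := vf_lin X 1 f g; rewrite !mul1r. Qed.

Definition add_vf (X Y : VF) : VF.
Proof.
exists (fun f => X f + Y f).
- abstract by move=> a f g /=; rewrite !vf_lin mulrDr addrACA.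
- abstract by move=> f g /=; rewrite !vf_leib mulrDr mulrDl addrACA.
Defined.

Definition scale_vf (h : C) (X : VF) : VF.
Proof.
exists (fun f => h * X f).
- abstract by move=> a f g /=; rewrite vf_lin mulrDr mulrCA.
- abstract by move=> f g /=; rewrite vf_leib mulrDr mulrCA -[h * X f * g]mulrA.
Defined.

Definition zero_vf : VF.
Proof.
exists (fun=> 0).
- abstract by move=> a f g /=; rewrite mulr0 addr0.
- abstract by move=> f g /=; rewrite mulr0 mul0r addr0.
Defined.

Definition opp_vf (X : VF) : VF := scale_vf (-1) X.

HB.instance Definition _ := gen_eqMixin VF.
HB.instance Definition _ := gen_choiceMixin VF.

Fact add_vfA : associative add_vf.
Proof. by move=> X Y Z; apply: vf_ext => f; exact: addrA. Qed.
Fact add_vfC : commutative add_vf.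
Proof. by move=> X Y; apply: vf_ext => f; exact: addrC. Qed.
Fact add_0vf : left_id zero_vf add_vf.
Proof. by move=> X; apply: vf_ext => f; exact: add0r. Qed.
Fact add_Nvf : left_inverse zero_vf opp_vf add_vf.
Proof. by move=> X; apply: vf_ext => f; rewrite /= mulN1r addNr. Qed.
HB.instance Definition _ :=
  GRing.isZmodule.Build VF add_vfA add_vfC add_0vf add_Nvf.

Fact scale_vfA f g X : scale_vf f (scale_vf g X) = scale_vf (f * g) X.
Proof. by apply: vf_ext => x; exact: mulrA. Qed.
Fact scale_1vf : left_id 1 scale_vf.
Proof. by move=> X; apply: vf_ext => x; exact: mul1r. Qed.
Fact scale_vfDr : right_distributive scale_vf +%R.
Proof. by move=> f X Y; apply: vf_ext => x; exact: mulrDr. Qed.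
Fact scale_vfDl X : {morph scale_vf^~ X : f g / f + g}.
Proof. by move=> f g; apply: vf_ext => x; exact: mulrDl. Qed.
HB.instance Definition _ := GRing.Zmodule_isLmodule.Build C VF
  scale_vfA scale_1vf scale_vfDr scale_vfDl.

Definition lie_vf (X Y : VF) : VF.
Proof.
exists (fun f => X (Y f) - Y (X f)).
- abstract by move=> a f g /=; rewrite !vf_lin mulrBr opprD addrACA.
- abstract (move=> f g /=; rewrite !vf_leib !vfD !vf_leib mulrBr mulrBl;
    rewrite ![Y f * _]mulrC ![_ * Y f]mulrC; apply: cf_ext => x /=; ring).
Defined.

End VectorFields.

Section GaugeAlgebroid.
Variables (R : realType) (M : manifold R) (E : vbundle M).
Local Notation C := (Cinf M).

(** Sections of the gauge Lie algebroid of [E].  When [E] has positive rank the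
    symbol [dsym] is determined by the operator [dop]. *)
Record DE := MkDE {
  dop :> Sec E -> Sec E;
  dsym : VF M;
  dop_lin : forall (a : R) (u v : Sec E),
    dop (cst_cf M a *: u + v) = cst_cf M a *: dop u + dop v;
  dop_leib : forall (f : C) (u : Sec E), dop (f *: u) = f *: dop u + dsym f *: u }.

Lemma de_ext (d r : DE) : (forall u, d u = r u) -> dsym d = dsym r -> d = r.
Proof.
case: d r => [d X dl dL] [r Y rl rL] /= /funext e eX; rewrite e eX in dl dL *.
by congr MkDE; exact: Prop_irrelevance.
Qed.

Lemma dopD (d : DE) u v : d (u + v) = d u + d v.
Proof. by have := dop_lin d 1 u v; rewrite !scale1r. Qed.

Definition add_de (d r : DE) : DE.
Proof.
exists (fun u => d u + r u) (dsym d + dsym r).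
- abstract by move=> a u v /=; rewrite !dop_lin scalerDr addrACA.
- abstract by move=> f u /=; rewrite !dop_leib scalerDr scalerDl addrACA.
Defined.

Definition scale_de (h : C) (d : DE) : DE.
Proof.
exists (fun u => h *: d u) (h *: dsym d).
- abstract by move=> a u v /=; rewrite dop_lin scalerDr !scalerA mulrC.
- abstract by move=> f u /=; rewrite dop_leib scalerDr !scalerA (mulrC f).
Defined.

Definition zero_de : DE.
Proof.
exists (fun=> 0) 0.
- abstract by move=> a f g /=; rewrite scaler0 addr0.
- abstract by move=> f u /=; rewrite scaler0 scale0r addr0.
Defined.

Definition opp_de (d : DE) : DE := scale_de (-1) d.

HB.instance Definition _ := gen_eqMixin DE.
HB.instance Definition _ := gen_choiceMixin DE.

Fact add_deA : associative add_de.
Proof. by move=> X Y Z; apply: de_ext => [u|]; exact: addrA. Qed.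
Fact add_deC : commutative add_de.
Proof. by move=> X Y; apply: de_ext => [u|]; exact: addrC. Qed.
Fact add_0de : left_id zero_de add_de.
Proof. by move=> X; apply: de_ext => [u|]; exact: add0r. Qed.
Fact add_Nde : left_inverse zero_de opp_de add_de.
Proof. by move=> X; apply: de_ext => [u|]; rewrite /= scaleN1r addNr. Qed.
HB.instance Definition _ :=
  GRing.isZmodule.Build DE add_deA add_deC add_0de add_Nde.

Fact scale_deA f g X : scale_de f (scale_de g X) = scale_de (f * g) X.
Proof. by apply: de_ext => [u|]; exact: scalerA. Qed.
Fact scale_1de : left_id 1 scale_de.
Proof. by move=> X; apply: de_ext => [u|]; exact: scale1r. Qed.
Fact scale_deDr : right_distributive scale_de +%R.
Proof. by move=> f X Y; apply: de_ext => [u|]; exact: scalerDr. Qed.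
Fact scale_deDl X : {morph scale_de^~ X : f g / f + g}.
Proof. by move=> f g; apply: de_ext => [u|]; exact: scalerDl. Qed.
HB.instance Definition _ := GRing.Zmodule_isLmodule.Build C DE
  scale_deA scale_1de scale_deDr scale_deDl.

Fact lie_de_aux (V : zmodType) (a b c d a' d' : V) :
  a + b + (c + d) - (a' + c + (b + d')) = a - a' + (d - d').
Proof.
have -> : a' + c + (b + d') = (c + b) + (a' + d').
  by rewrite [a' + c]addrC addrACA.
rewrite [c + d]addrC addrACA [b + c]addrC.
by rewrite addrKA opprD addrACA.
Qed.

Definition lie_de (d r : DE) : DE.
Proof.
exists (fun u => d (r u) - r (d u)) (lie_vf (dsym d) (dsym r)).
- abstract by move=> a u v /=; rewrite !dop_lin scalerBr opprD addrACA.
- abstract (move=> f u /=; rewrite !dop_leib !dopD !dop_leib scalerBr scalerBl;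
    exact: lie_de_aux).
Defined.

Definition id_de : DE.
Proof.
exists id 0.
- abstract by [].
- abstract by move=> f u /=; rewrite scale0r addr0.
Defined.

End GaugeAlgebroid.

Section Jets.
Variables (R : realType) (M : manifold R) (E : vbundle M).
Local Notation C := (Cinf M).

(** The fibre of the first jet bundle at [x] is regarded as a subspace of
    Hom((DE)_x, E_x), the jet at [x] of a section [u] being the map that sends
    the value at [x] of an operator [d] to [d u x]; it consists of
    the [nu] such that nu(Phi) = Phi(nu(1)) for all Phi in gl(E) (Chen and Liu,
    Omni-Lie algebroids).  Sections of the jet bundle are thus C^oo(M)-linear
    maps, and [mu d] is the E-valued pairing. *)
Record JE := MkJE {
  jet :> DE E -> Sec E;
  jet_lin : forall (f : C) (d r : DE E), jet (f *: d + r) = f *: jet d + jet r;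
  jet_gl : forall phi : DE E, dsym phi = 0 -> jet phi = phi (jet (id_de E)) }.

Lemma jet_ext (m n : JE) : (forall d, m d = n d) -> m = n.
Proof.
case: m n => [m ml mg] [n nl ng] /= /funext e; rewrite e in ml mg *.
by congr MkJE; exact: Prop_irrelevance.
Qed.

Lemma dop0 (d : DE E) : d 0 = 0.
Proof. by have := dop_leib d 0 0; rewrite !scaler0 scale0r addr0. Qed.

Lemma dop_gl (phi : DE E) (f : C) u : dsym phi = 0 -> phi (f *: u) = f *: phi u.
Proof. by move=> p0; rewrite dop_leib p0 scale0r addr0. Qed.

Lemma jet0 (m : JE) : m 0 = 0.
Proof.
have := jet_lin m (-1) 0 0; rewrite scaler0 addr0 => {1}->.
by rewrite scaleN1r addNr.
Qed.

Definition add_je (m n : JE) : JE.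
Proof.
exists (fun d => m d + n d).
- abstract by move=> f d r /=; rewrite !jet_lin scalerDr addrACA.
- abstract by move=> phi p0 /=; rewrite dopD -!jet_gl.
Defined.

Definition scale_je (h : C) (m : JE) : JE.
Proof.
exists (fun d => h *: m d).
- abstract by move=> f d r /=; rewrite jet_lin scalerDr !scalerA mulrC.
- abstract by move=> phi p0 /=; rewrite (dop_gl _ _ p0) -jet_gl.
Defined.

Definition zero_je : JE.
Proof.
exists (fun=> 0).
- abstract by move=> f d r /=; rewrite scaler0 addr0.
- abstract by move=> phi p0 /=; rewrite dop0.
Defined.

Definition opp_je (m : JE) : JE := scale_je (-1) m.

HB.instance Definition _ := gen_eqMixin JE.
HB.instance Definition _ := gen_choiceMixin JE.

Fact add_jeA : associative add_je.
Proof. by move=> X Y Z; apply: jet_ext => u; exact: addrA. Qed.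
Fact add_jeC : commutative add_je.
Proof. by move=> X Y; apply: jet_ext => u; exact: addrC. Qed.
Fact add_0je : left_id zero_je add_je.
Proof. by move=> X; apply: jet_ext => u; exact: add0r. Qed.
Fact add_Nje : left_inverse zero_je opp_je add_je.
Proof. by move=> X; apply: jet_ext => u; rewrite /= scaleN1r addNr. Qed.
HB.instance Definition _ :=
  GRing.isZmodule.Build JE add_jeA add_jeC add_0je add_Nje.

Fact scale_jeA f g X : scale_je f (scale_je g X) = scale_je (f * g) X.
Proof. by apply: jet_ext => u; exact: scalerA. Qed.
Fact scale_1je : left_id 1 scale_je.
Proof. by move=> X; apply: jet_ext => u; exact: scale1r. Qed.
Fact scale_jeDr : right_distributive scale_je +%R.
Proof. by move=> f X Y; apply: jet_ext => u; exact: scalerDr. Qed.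
Fact scale_jeDl X : {morph scale_je^~ X : f g / f + g}.
Proof. by move=> f g; apply: jet_ext => u; exact: scalerDl. Qed.
HB.instance Definition _ := GRing.Zmodule_isLmodule.Build C JE
  scale_jeA scale_1je scale_jeDr scale_jeDl.

Definition jet_proj (m : JE) : Sec E := m (id_de E).

Definition jetd (u : Sec E) : JE.
Proof.
exists (fun d => d u).
- abstract by [].
- abstract by [].
Defined.

(** Sections of Hom(TM, E), and their inclusion into sections of the jet
    bundle; [jetd_scale] is the rule d(f u) = f d u + df (x) u. *)
Record HomTE := MkHomTE {
  homf :> VF M -> Sec E;
  hom_lin : forall (f : C) X Y, homf (f *: X + Y) = f *: homf X + homf Y }.

Lemma hom0 (y : HomTE) : y 0 = 0.
Proof.
have := hom_lin y (-1) 0 0; rewrite scaler0 addr0 => {1}->.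
by rewrite scaleN1r addNr.
Qed.

Definition jet_hom (y : HomTE) : JE.
Proof.
exists (fun d => y (dsym d)).
- abstract by move=> f d r /=; exact: hom_lin.
- abstract by move=> phi /= ->; rewrite hom0 dop0.
Defined.

Definition df_tensor (f : C) (u : Sec E) : HomTE.
Proof.
exists (fun X : VF M => X f *: u).
abstract by move=> h X Y /=; rewrite scalerA -scalerDl.
Defined.

Lemma jetd_scale f u : jetd (f *: u) = f *: jetd u + jet_hom (df_tensor f u).
Proof. by apply: jet_ext => d /=; exact: dop_leib. Qed.

Fact lie_de_lin (d r s : DE E) f :
  lie_de d (f *: r + s) = f *: lie_de d r + dsym d f *: r + lie_de d s.
Proof.
apply: de_ext => [u|]; last first.
  apply: vf_ext => g /=; apply: cf_ext => x /=.
  by rewrite vfD vf_leib /=; ring.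
rewrite /= dopD dop_leib opprD scalerBr.
by rewrite addrACA -!addrA; congr (_ + _); rewrite addrCA.
Qed.

Fact lie_vf0 (X : VF M) : lie_vf X 0 = 0.
Proof.
have X0 : X 0 = 0 by have := vf_leib X 0 0; rewrite !mul0r mulr0 addr0.
by apply: vf_ext => f /=; rewrite X0 subrr.
Qed.

Fact lie_de_id (d : DE E) : lie_de d (id_de E) = 0.
Proof.
by apply: de_ext => [u|] /=; [rewrite subrr|exact: lie_vf0].
Qed.

Fact lie_jet_aux (V : zmodType) (a b d a' d' : V) :
  a + b + d - (a' + (b + d')) = a - a' + (d - d').
Proof. by rewrite -(lie_de_aux a b 0 d a' d') add0r addr0. Qed.

Definition lie_jet (d : DE E) (m : JE) : JE.
Proof.
exists (fun r => d (m r) - m (lie_de d r)).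
- abstract (move=> f r s /=; rewrite lie_de_lin -addrA !jet_lin dopD dop_leib
    scalerBr; exact: lie_jet_aux).
- abstract (move=> phi p0 /=; rewrite lie_de_id jet0 subr0
    (jet_gl m (phi := lie_de d phi)) /= ?p0 ?lie_vf0 // jet_gl //;
    by rewrite opprB addrC subrK).
Defined.

End Jets.

(* A vector bundle is handled through its C^oo(M)-module [V] of sections and
   the relation [van x s], "the section [s] vanishes at [x]"; two sections have
   the same value at [x] when their difference vanishes there.  A subbundle is
   identified with the set of its sections. *)

Section Subbundles.
Variables (R : realType) (M : manifold R) (V : lmodType (Cinf M)).
Variable van : M -> V -> Prop.
Implicit Types (S : set V) (x : M).

Definition same_value x (s t : V) : Prop := van x (s - t).

Definition in_fibre S x (s : V) : Prop := exists2 t, S t & same_value x s t.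

(** The values at [x] of the sections [e i] form a basis of the space of values
    at [x] of the elements of [S]. *)
Definition frame_at S (k : nat) (e : 'I_k -> V) x : Prop :=
  [/\ forall i, S (e i),
      forall c : 'I_k -> R,
        van x (\sum_(i < k) cst_cf M (c i) *: e i) -> forall i, c i = 0 &
      forall s, S s -> exists c : 'I_k -> R,
        same_value x s (\sum_(i < k) cst_cf M (c i) *: e i)].

(** [S] is the space of all sections of a subbundle of rank [k]. *)
Definition subbundle (k : nat) S : Prop :=
  [/\ S 0,
      forall (f : Cinf M) s t, S s -> S t -> S (f *: s + t),
      forall s, (forall x, in_fibre S x s) -> S s &
      forall x, exists U : set M, [/\ open U, U x &
        exists e : 'I_k -> V, forall y, U y -> frame_at S e y]].

Definition constant_rank S : Prop :=
  exists k, forall x, exists e : 'I_k -> V, frame_at S e x.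

End Subbundles.

Section OmniLie.
Variables (R : realType) (M : manifold R) (E : vbundle M).

(** Sections of TM (+) E and of DE (+) JE. *)
Definition TE : Type := (VF M * Sec E)%type.
HB.instance Definition _ := GRing.Lmodule.on TE.
Definition omni : Type := (DE E * JE E)%type.
HB.instance Definition _ := GRing.Lmodule.on omni.

Implicit Types (X Y : omni) (a b c t : TE).

Definition van_TE (x : M) t : Prop := (forall f, t.1 f x = 0) /\ t.2 x = 0.

Definition van_omni (x : M) X : Prop :=
  (forall u, X.1 u x = 0) /\ (forall d, X.2 d x = 0).

Definition inE (u : Sec E) : TE := (0, u).

Definition bmap X : TE := (dsym X.1, jet_proj X.2).

Definition dorfman X Y : omni :=
  (lie_de X.1 Y.1, lie_jet X.1 Y.2 - lie_jet Y.1 X.2 + jetd (X.2 Y.1)).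

Definition half : Cinf M := cst_cf M 2^-1.

Definition pairing X Y : Sec E := half *: (Y.2 X.1 + X.2 Y.1).

Definition perp (S : set omni) : set omni :=
  [set X | forall Y, S Y -> pairing X Y = 0].

Definition normalizer (S : set omni) : set omni :=
  [set X | forall Y, S Y -> S (dorfman X Y)].

(** [bimage L] is the set of sections of the bundle [b(L)], taken fibrewise. *)
Definition bimage (L : set omni) : set TE :=
  [set t | forall x, in_fibre van_TE [set bmap X | X in L] x t].

Definition bpreimage (A : set TE) : set omni := bmap @^-1` A.

(** A^0: sections Phi + y of gl(E) (+) Hom(TM, E) that annihilate [A]. *)
Definition annihilator (A : set TE) : set omni :=
  [set X | exists (phi : DE E) (y : HomTE E), [/\ dsym phi = 0,
     X = (phi, jet_hom y) & forall a, A a -> phi a.2 + y a.1 = 0]].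

Definition dirac (L : set omni) : Prop :=
  [/\ exists k, subbundle van_omni k L, L = perp L &
      forall X Y, L X -> L Y -> L (dorfman X Y)].

Definition reducible (L : set omni) : Prop := constant_rank van_TE (bimage L).

(** The bracket [br] is only meaningful on sections of [A]; the anchor of [A] is
    the first projection. *)
Record projective_lie_algebroid (k : nat) (A : set TE) (br : TE -> TE -> TE) :
    Prop := ProjectiveLieAlgebroid {
  pla_subbundle : subbundle van_TE k A;
  pla_closed : forall a b, A a -> A b -> A (br a b);
  pla_linear : forall (r : R) a b c, A a -> A b -> A c ->
    br (cst_cf M r *: a + b) c = cst_cf M r *: br a c + br b c;
  pla_skew : forall a b, A a -> A b -> br b a = - br a b;
  pla_jacobi : forall a b c, A a -> A b -> A c ->
    br (br a b) c + br (br b c) a + br (br c a) b = 0;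
  pla_leibniz : forall (f : Cinf M) a b, A a -> A b ->
    br a (f *: b) = f *: br a b + a.1 f *: b }.

Definition lifted_dirac (A : set TE) (br : TE -> TE -> TE) (L : set omni) :
    Prop :=
  [/\ dirac L, reducible L, bimage L = A &
      forall X Y, L X -> L Y -> bmap (dorfman X Y) = br (bmap X) (bmap Y)].

(** A bundle map from the exterior square of [A] to the intersection of [A] and
    [E], given on sections of [A]. *)
Definition bundle_map (A : set TE) (Omega : TE -> TE -> TE) : Prop :=
  [/\ forall a b, A a -> A b -> A (Omega a b) /\ (Omega a b).1 = 0,
      forall (f : Cinf M) a b c, A a -> A b -> A c ->
        Omega (f *: a + b) c = f *: Omega a c + Omega b c &
      forall a b, A a -> A b -> Omega b a = - Omega a b].

Definition generates_deformation k A br (Omega : TE -> TE -> TE) : Prop :=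
  forall eps : R,
    projective_lie_algebroid k A (fun a b => br a b + cst_cf M eps *: Omega a b).

Definition cochain X : omni -> Sec E := pairing X.

(** The coboundary of a 1-cochain, for the representation [X |-> X.1] on E. *)
Definition coboundary (w : omni -> Sec E) X Y : Sec E :=
  X.1 (w Y) - Y.1 (w X) - w (dorfman X Y).

(** [b^* Omega = d_L omega_X], the E-valued right-hand side being seen in TM (+) E. *)
Definition pullback_exact (L : set omni) (Omega : TE -> TE -> TE) X : Prop :=
  forall l1 l2, L l1 -> L l2 ->
    Omega (bmap l1) (bmap l2) = inE (coboundary (cochain X) l1 l2).

(** Some [Y] with [bmap Y = t]; the value of [falling] does not depend on the
    choice. *)
Definition lift t : omni := xget 0 [set Y | bmap Y = t].

Definition falling X t : TE := bmap (dorfman X (lift t)).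

Definition omega_formula (A : set TE) br (Omega : TE -> TE -> TE) X : Prop :=
  forall a1 a2, A a1 -> A a2 ->
    Omega a1 a2 = half *: (br (falling X a1) a2 + br a1 (falling X a2)
                           - falling X (br a1 a2)).

Definition torsion (br : TE -> TE -> TE) X a b : TE :=
  falling X (br (falling X a) b + br a (falling X b) - falling X (br a b))
  - br (falling X a) (falling X b).

Definition torsion_closed (A : set TE) (br : TE -> TE -> TE) X : Prop :=
  forall a b c, A a -> A b -> A c ->
    br (torsion br X a b) c + torsion br X (br a b) c
    + (br (torsion br X b c) a + torsion br X (br b c) a)
    + (br (torsion br X c a) b + torsion br X (br c a) b) = 0.

End OmniLie.

(* Main.v *)
Require Import Defs.
From mathcomp Require Import all_boot all_order all_algebra.
From mathcomp Require Import all_classical all_reals all_analysis.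
From mathcomp Require Import ring.

(** The bracket of a lifted Dirac structure [L] and the invariance of the
    E-valued pairing give, for [X] normalizing b^-1(A) and [l1, l2] in [L],

      [X.b(l1), b(l2)] + [b(l1), X.b(l2)] - X.[b(l1), b(l2)]
        = - 2 ({X, l1}, l2) = 2 (d_L omega_X)(l1, l2),

    the second equality holding for every [X].  Both sides of (1) are
    C^oo(M)-bilinear on [A], and [A] is locally spanned by b(L), so this is (1).
    The two normalizers agree because A^0 and b^-1(A) are orthogonal to each
    other and the pairing is invariant; if b^*Omega = d_L omega_X, then for [h]
    in A^0 the identity above gives ({X, h}, l) = 0 for all [l] in [L], so
    {X, h} lies in [L] and in the kernel of b, that is, in A^0.  Finally (1)
    says that Omega is half the Nijenhuis deformation of the bracket of [A] by
    the operator X., which is a cocycle and whose Jacobiator is the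
    coboundary of the torsion T^X.

    Three facts about a manifold are needed: bump functions; a global connection
    on [E] (so that b is onto), obtained by patching D u = sum_j X(chi u_j) chi
    e_j with the locally finite partition of unity psi_n prod_(i < n) (1 - psi_i);
    and enough C^oo(M)-linear functionals on sections of TM (+) E.  Since a
    vector field is a derivation, the functionals X |-> X f separate vector
    fields at a point by definition, and Hadamard's lemma is not required. *)

Set Implicit Arguments.
Unset Strict Implicit.
Unset Printing Implicit Defensive.

Import Order.TTheory GRing.Theory Num.Theory numFieldNormedType.Exports.
Local Open Scope classical_set_scope.
Local Open Scope ring_scope.

(** * Smooth functions with compact support *)

Section FlatFunction.
Variable R : realType.

(** The powers of 1/t close the family under differentiation: the derivative of [flat j] is a
    combination of [flat j.+2] and [flat j.+1], so all orders of smoothness come from one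
    induction. *)
Definition flat (j : nat) (t : R) : R :=
  if 0 < t then t^-1 ^+ j * expR (- t^-1) else 0.

Lemma flat_le0 j t : t <= 0 -> flat j t = 0.
Proof. by rewrite /flat ltNge => ->. Qed.

Lemma flat_gt0 j t : 0 < t -> 0 < flat j t.
Proof. by move=> t0; rewrite /flat t0 mulr_gt0 ?exprn_gt0 ?invr_gt0 ?expR_gt0. Qed.

Lemma flat_ge0 j t : 0 <= flat j t.
Proof. by have [/(flat_gt0 j)/ltW //|/(flat_le0 j)->] := ltP 0 t. Qed.

(** For t > 0 this is exp(s) >= s^(j+2)/(j+2)! at s = 1/t. The quadratic bound forces the derivative
    at 0 to be 0. *)
Lemma flat_le_sqr j t : flat j t <= j.+2`!%:R * t ^+ 2.
Proof.
rewrite /flat; case: ltP => t0; last by rewrite mulr_ge0 ?ler0n ?sqr_ge0.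
have s0 : 0 <= t^-1 by rewrite invr_ge0 ltW.
have f0 : 0 < j.+2`!%:R :> R by rewrite ltr0n fact_gt0.
have h := expR_ge1Dxn j.+1 s0.
have h1 : t^-1 ^+ j.+2 <= j.+2`!%:R * expR t^-1.
  rewrite mulrC -ler_pdivrMr //; apply: le_trans h.
  by rewrite lerDr.
have -> : t^-1 ^+ j * expR (- t^-1) = t ^+ 2 * (t^-1 ^+ j.+2 / expR t^-1).
  rewrite expRN !exprS; field; rewrite ?gt_eqF ?expR_gt0 //.
rewrite mulrC ler_pM2r ?exprn_gt0 // ler_pdivrMr ?expR_gt0 //.
Qed.

Lemma is_derive_flat j (t : R) :
  is_derive t 1 (flat j) (flat j.+2 t - j%:R * flat j.+1 t).
Proof.
have [t0|t0|->] := ltgtP t 0.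
- rewrite !flat_le0 ?ltW // mulr0 subr0.
  apply: (near_eq_is_derive _ (is_derive_cst (0 : R) t 1)).
  near=> s; rewrite flat_le0 //; apply: ltW; near: s; exact: lt_nbhsl.
- apply: (@near_eq_is_derive R R R
    ((fun s => s^-1) ^+ j * (fun s => expR (- s^-1))) (flat j)).
    by near=> s; rewrite /flat ifT ?exprfctE //; near: s; exact: lt_nbhsr.
  have dV : is_derive t 1 (fun s : R => s^-1) (- t ^- 2).
    apply: (is_derive_eq (is_deriveV (lt0r_neq0 t0) (is_derive_id t 1))).
    by rewrite /GRing.scale /= mulr1.
  have dE : is_derive t 1 (fun s : R => expR (- s^-1)) (expR (- t^-1) * - - t ^- 2).
    exact: (@is_derive1_comp R expR (fun s => - s^-1) t _ _
              (is_derive_expR (- t^-1)) (is_deriveN dV)).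
  apply: (is_derive_eq (is_deriveM (is_deriveX j dV) dE)).
  rewrite exprfctE /flat t0 /GRing.scale /= opprK.
  case: j => [|j] /=; rewrite ?exprS ?expr0.
    by field; exact: lt0r_neq0.
  by field; exact: lt0r_neq0.
rewrite !flat_le0 // mulr0 subr0.
have L : h^-1 *: ((flat j \o shift 0) (h *: (1 : R)) - flat j 0)
    @[h --> 0^'] --> (0 : R).
  have c0 : 0 < j.+2`!%:R :> R by rewrite ltr0n fact_gt0.
  apply/cvgrPdist_le => e e0; rewrite /= (flat_le0 _ (lexx 0)).
  near=> h; have h0 : h != 0 by near: h; exact: nbhs_dnbhs_neq.
  rewrite sub0r normrN subr0 addr0 normrZ normfV ler_pdivrMl ?normr_gt0 //.
  rewrite (ger0_norm (flat_ge0 _ _)) /GRing.scale /= mulr1.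
  apply: le_trans (flat_le_sqr _ _) _.
  rewrite -real_normK ?num_real // expr2 mulrCA ler_pM2l ?normr_gt0 //.
  rewrite mulrC -ler_pdivlMr //.
  by near: h; apply: dnbhs0_le; rewrite divr_gt0.
apply: DeriveDef; first by apply/cvg_ex; exists 0.
exact: cvg_lim L.
Unshelve. all: by end_near.
Qed.
(** The usual smooth step, equal to 0 for t <= 0 and to 1 for t >= 1. *)
Definition plateau (t : R) : R := flat 0 t / (flat 0 t + flat 0 (1 - t)).

Lemma plateau_den_gt0 t : 0 < flat 0 t + flat 0 (1 - t).
Proof.
have [t0|t0] := ltP 0 t; first by rewrite ltr_pwDl ?flat_gt0 ?flat_ge0.
by rewrite ltr_wpDl ?flat_ge0 // flat_gt0 // subr_gt0 (le_lt_trans t0).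
Qed.

Lemma plateau_le0 t : t <= 0 -> plateau t = 0.
Proof. by move=> t0; rewrite /plateau flat_le0 // mul0r. Qed.

Lemma plateau_ge1 t : 1 <= t -> plateau t = 1.
Proof.
move=> t1; rewrite /plateau (flat_le0 0 (t := 1 - t)) ?subr_le0 // addr0 divff //.
by rewrite gt_eqF // flat_gt0 ?(lt_le_trans ltr01).
Qed.

End FlatFunction.

(** * Smoothness of composites and inverses *)

Section SmoothFunctionsOfSmoothFunctions.
Variables (R : realType) (n : nat).
Implicit Types (U V : set 'rV[R]_n) (f g : 'rV[R]_n -> R).

Lemma Ck_sub k U V f : V `<=` U -> Ck k U f -> Ck k V f.
Proof.
move=> VU; elim: k f => [|k IH] f /=; first by move=> cf p /VU /cf.
by move=> [df cf]; split=> [p /VU /df //|v]; exact: IH.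
Qed.

Lemma Ck_local k U f :
  (forall p, U p -> exists2 V, V p & Ck k V f) -> Ck k U f.
Proof.
elim: k f => [|k IH] f loc /=.
  by move=> p /loc[V Vp cf]; exact: cf.
split=> [p /loc[V Vp [df _]]|v]; first exact: df.
by apply: IH => p /loc[V Vp [_ cf]]; exists V => //; exact: cf.
Qed.

Lemma diff_comp_real (h : R -> R) (c : R) f p (v : 'rV[R]_n) :
  is_derive (f p) 1 h c -> differentiable f p ->
  differentiable (h \o f) p /\ 'd (h \o f) p v = c * 'd f p v.
Proof.
move=> [dh <-] df; have dh' := (derivable1_diffP h (f p)).1 dh.
split; first exact: differentiable_comp.
by rewrite diff_comp //= diff1E // /= derive1E mulrC.
Qed.

Lemma Ck_comp_flat k j U f : open U -> Ck k U f -> Ck k U (flat j \o f).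
Proof.
move=> oU; elim: k j f => [|k IH] j f.
  move=> cf p Up; apply: (@continuous_comp _ _ _ f (flat j)); first exact: cf.
  by have [/derivable1_diffP/differentiable_continuous] := is_derive_flat j (f p).
move=> Cf; have [df cf] := Cf; have Cf' := CkS Cf.
have dd p v (Up : U p) := diff_comp_real v (is_derive_flat j (f p)) (df p Up).
split=> [p Up|v]; first by have [] := dd p 0 Up.
have c := CkM oU
  (CkD oU (IH j.+2 f Cf') (CkM oU (Ck_cst k U (- j%:R)) (IH j.+1 f Cf'))) (cf v).
apply: (Ck_ext oU _ c) => p Up /=; have [_ ->] := dd p v Up.
by rewrite mulNr.
Qed.

Lemma Ck_inv k U f : open U -> (forall p, U p -> f p != 0) ->
  Ck k U f -> Ck k U (fun p => (f p)^-1).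
Proof.
move=> oU f0; elim: k => [|k IH] /=.
  by move=> cf p Up; exact: (cvgV (f0 p Up) (cf p Up)).
move=> [df cf]; have Cf' : Ck k U f by apply: CkS.
have dd p v (Up : U p) := diff_comp_real v
  (@is_deriveV R id (f p) 1 1 (f0 p Up) (is_derive_id _ _)) (df p Up).
split=> [p Up|v]; first by have [] := dd p 0 Up.
have c := CkM oU (CkM oU (Ck_cst k U (-1)) (CkM oU (IH Cf') (IH Cf'))) (cf v).
apply: (Ck_ext oU _ c) => p Up /=; have [_ ->] := dd p v Up.
by rewrite /GRing.scale /= mulr1 mulN1r expr2 invfM.
Qed.

Lemma Ck_plateau k U f : open U -> Ck k U f -> Ck k U (@plateau R \o f).
Proof.
move=> oU Cf; have Cf1 : Ck k U (fun p => 1 - f p).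
  apply: Ck_ext (CkD oU (Ck_cst k U 1) (CkM oU (Ck_cst k U (-1)) Cf)) => // p _.
  by rewrite mulN1r.
have C0 := Ck_comp_flat 0 oU Cf; have C1 := Ck_comp_flat 0 oU Cf1.
apply: CkM => //; apply: Ck_inv => //; last exact: CkD.
by move=> p _; rewrite gt_eqF // plateau_den_gt0.
Qed.

End SmoothFunctionsOfSmoothFunctions.

(** * Bump functions on a manifold *)

Section Bump.
Variables (R : realType).

Lemma Ck_sum n k (U : set 'rV[R]_n) (I : Type) (r : seq I)
    (f : I -> 'rV[R]_n -> R) : open U -> (forall j, Ck k U (f j)) ->
  Ck k U (fun p => \sum_(j <- r) f j p).
Proof.
move=> oU Cf; elim: r => [|j r IH].
  by apply: Ck_ext (Ck_cst k U 0) => // p _; rewrite big_nil.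
by apply: Ck_ext (CkD oU (Cf j) IH) => // p _; rewrite big_cons.
Qed.

Lemma Ck_sqr_sub n k (U : set 'rV[R]_n) f (a : R) : open U -> Ck k U f ->
  Ck k U (fun p => (f p - a) ^+ 2).
Proof.
move=> oU Cf; have Cfa := CkD oU Cf (Ck_cst k U (- a)).
exact: (CkM oU Cfa Cfa).
Qed.

Lemma mx_norm_le_sum_sqr n (v : 'rV[R]_n) (r : R) : 0 <= r ->
  \sum_(j < n) v 0 j ^+ 2 <= r ^+ 2 -> `|v| <= r.
Proof.
move=> r0 le; rewrite [leLHS]/Num.Def.normr /= mx_normrE.
rewrite bigmax_le //= => -[i j] _ /=.
rewrite ord1 -(ler_pXn2r (n := 2)) ?nnegrE //.
rewrite real_normK ?num_real //; apply: le_trans le.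
by rewrite (bigD1 j) //= lerDl sumr_ge0 // => l _; exact: sqr_ge0.
Qed.

Variable M : manifold R.
Implicit Types (U V : set M) (f g : M -> R).

Lemma smooth_fun_sub U V f : V `<=` U -> smooth_fun U f -> smooth_fun V f.
Proof.
by move=> VU sf c Mc k; apply: Ck_sub (sf c Mc k) => p [Rp /VU].
Qed.

Lemma smooth_fun_local U f :
  (forall x, U x -> exists2 V, V x & smooth_fun V f) -> smooth_fun U f.
Proof.
move=> loc c Mc k; apply: Ck_local => p [Rp /loc[V Vp sf]].
by exists (cran c `&` cinv c @^-1` V) => //; exact: sf.
Qed.

Lemma closed_chart_image (c : chart R M (mdim M)) (B : set 'rV[R]_(mdim M)) :
  matlas c -> compact B -> B `<=` cran c -> closed (cinv c @` B).
Proof.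
move=> Mc cB Bc; have [_ _ _ _ [_ ci]] := m_chart Mc.
apply: (compact_closed (@m_hausdorff R M)).
apply: continuous_compact cB; apply: continuous_in_subspaceT => p.
by rewrite inE => /Bc/ci.
Qed.

Lemma bump_function (x : M) U : open U -> U x ->
  exists chi : Cinf M, (\forall y \near x, chi y = 1) /\
    exists K, [/\ closed K, K `<=` U & forall y, ~ K y -> chi y = 0].
Proof.
move=> oU Ux; have [c Mc cx] := m_cover x.
have [oD oR c1 c2 [cc ci]] := m_chart Mc.
set p0 := cmap c x; have [Rp0 ip0] := c1 x cx.
have : nbhs p0 (cran c `&` cinv c @^-1` U).
  apply: open_nbhs_nbhs; split; first exact: open_chart_preim.
  by split=> //=; rewrite ip0.
move=> /nbhs_ballP[r0 /= r00 sub].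
pose r := r0 / 2; have r_gt0 : 0 < r by rewrite divr_gt0.
pose B := [set p : 'rV[R]_(mdim M) | `|p0 - p| <= r].
have BO : B `<=` cran c `&` cinv c @^-1` U.
  move=> p Bp; apply: sub; rewrite -ball_normE /=; apply: le_lt_trans Bp _.
  by rewrite /r ltr_pdivrMr // mulr_natr mulr2n ltrDl.
have cB : compact B.
  apply: bounded_closed_compact; last first.
    rewrite -[B]/(closed_ball_ Num.norm p0 r) -closed_ballE //.
    exact: closed_ball_closed.
  exists (`|p0| + r); split; first exact: num_real.
  move=> e /ltW he p /= Bp; apply: le_trans he.
  have -> : p = p0 - (p0 - p) by rewrite opprB addrC subrK.
  by apply: le_trans (ler_normB _ _) _; rewrite lerD2l.
have clK : closed (cinv c @` B) by apply: closed_chart_image => // p /BO[].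
(* Row vectors carry the maximum norm, so the smooth squared Euclidean distance [q] replaces it. The
   constants give [h] = 2 at the centre, hence [h] > 1 nearby, and [h] <= 0 outside [B]. *)
pose q (p : 'rV[R]_(mdim M)) : R := \sum_j (p 0 j - p0 0 j) ^+ 2.
pose h p : R := 2 - 2 / r ^+ 2 * q p.
have Ckh k (V : set 'rV[R]_(mdim M)) (g : 'rV[R]_(mdim M) -> 'rV[R]_(mdim M)) :
    open V -> (forall j, Ck k V (fun p => g p 0 j)) -> Ck k V (h \o g).
  move=> oV Cg.
  have Cq : Ck k V (q \o g) by apply: Ck_sum => // j; apply: Ck_sqr_sub.
  have Cl := CkM oV (Ck_cst k V (- (2 / r ^+ 2))) Cq.
  apply: Ck_ext (CkD oV (Ck_cst k V 2) Cl) => //.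
  by move=> p _; rewrite mulNr.
have qB p : ~ B p -> r ^+ 2 <= q p.
  move=> nB; rewrite leNgt; apply/negP => /ltW lt; apply: nB; rewrite /B /= distrC.
  apply: mx_norm_le_sum_sqr; [exact: ltW|apply: le_trans lt].
  by rewrite (eq_bigr (fun j => (p 0 j - p0 0 j) ^+ 2)) // => j _; rewrite !mxE.
pose chi y := if `[< cdom c y >] then plateau (h (cmap c y)) else 0.
have chi0 y : ~ (cinv c @` B) y -> chi y = 0.
  move=> nK; rewrite /chi; case: asboolP => // cy; apply: plateau_le0.
  rewrite /h subr_le0 mulrAC ler_pdivlMr ?exprn_gt0 // ler_pM2l //.
  by apply: qB => By; apply: nK; exists (cmap c y) => //; have [] := c1 y cy.
(* Two open sets cover M: the chart domain, and the complement of the image of [B], which is closed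
   because it is compact in a Hausdorff space. *)
have schi : smooth_fun setT chi.
  apply: smooth_fun_local => y _.
  have [cy|ncy] := pselect (cdom c y).
    exists (cdom c) => // c' Mc' k.
    have oW := open_chart_preim Mc' oD.
    apply: (Ck_ext (f := @plateau R \o (h \o (fun p => cmap c (cinv c' p)))) oW).
      by move=> p [_ /= Dp]; rewrite /chi; case: asboolP.
    by apply: Ck_plateau => //; apply: Ckh => // j; exact: m_compat.
  exists (~` (cinv c @` B)).
    move=> [p Bp py]; apply: ncy; rewrite -py.
    by have [Rp _] := BO p Bp; have [] := c2 p Rp.
  apply: (smooth_fun_ext _ _ (smooth_fun_cst _ 0)); first by rewrite openC.
  by move=> z nK; rewrite chi0.
exists (MkCinf schi); split; last first.
  by exists (cinv c @` B); split=> // _ [p /BO[_ ?] <-].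
have ch : {for p0, continuous h}.
  apply: (Ckh 0%N setT id openT) => // j p _; exact: coord_continuous.
have hc : h (cmap c y) @[y --> x] --> h p0.
  by apply: (@continuous_comp _ _ _ (cmap c) h); [exact: cc|exact: ch].
have h0 : h p0 = 2.
  by rewrite /h /q big1 ?mulr0 ?subr0 // => j _; rewrite subrr expr0n.
have h1 : \forall y \near x, 1 < h (cmap c y).
  by apply: (hc [set z | 1 < z]); rewrite h0; apply: lt_nbhsr; rewrite ltr1n.
near=> y; rewrite /= /chi; case: asboolP => [cy|[]]; last first.
  by near: y; exact: open_nbhs_nbhs.
by apply: plateau_ge1; apply: ltW; near: y.
Unshelve. all: by end_near.
Qed.

End Bump.

(** * Local frames and connections *)

Section LocalFrames.
Variables (R : realType) (M : manifold R) (E : vbundle M).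
Local Notation C := (Cinf M).

Lemma cf_sumE (I : Type) (r : seq I) (P : pred I) (f : I -> C) x :
  (\sum_(i <- r | P i) f i) x = \sum_(i <- r | P i) f i x.
Proof. by apply: (big_morph (fun g : C => g x)). Qed.

Lemma sec_sumE (I : Type) (r : seq I) (P : pred I) (s : I -> Sec E) x :
  (\sum_(i <- r | P i) s i) x = \sum_(i <- r | P i) s i x.
Proof. by apply: (big_morph (fun t : Sec E => t x)). Qed.

Lemma smooth_cutoff (chi : C) (K U : set M) f : closed K -> open U ->
  K `<=` U -> (forall x, ~ K x -> chi x = 0) -> smooth_fun U f ->
  smooth_fun setT (fun x => chi x * f x).
Proof.
move=> cK oU KU chi0 sf; apply: smooth_fun_local => x _.
have [Ux|nUx] := pselect (U x).
  exists U => //; apply: smooth_funM => //.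
  exact: smooth_funW (@cf_smooth _ _ chi).
exists (~` K); first by move=> /KU.
apply: (smooth_fun_ext _ _ (smooth_fun_cst _ 0)); first by rewrite openC.
by move=> y /chi0 ->; rewrite mul0r.
Qed.

Section Trivialization.
Variables (phi : triv (vrank E) E) (Vphi : vatlas phi).
Variables (chi : C) (K : set M).
Hypotheses (cK : closed K) (KU : K `<=` tdom phi)
  (chi0 : forall x, ~ K x -> chi x = 0).

Let oU : open (tdom phi). Proof. by have [] := v_triv Vphi. Qed.

Lemma chi_off x : ~ tdom phi x -> chi x = 0.
Proof. by move=> nU; apply: chi0 => /KU. Qed.

Lemma tmap_lin (psi : triv (vrank E) E) x a (u v : E x) : vatlas psi ->
  tdom psi x -> tmap psi (a *: u + v) = a *: tmap psi u + tmap psi v.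
Proof. by move=> /v_triv [_ lin] /lin [lx _]; exact: lx. Qed.

Lemma tmapZ (psi : triv (vrank E) E) x a (u : E x) : vatlas psi ->
  tdom psi x -> tmap psi (a *: u) = a *: tmap psi u.
Proof.
by move=> Vpsi Ux; have := tmap_lin a u 0 Vpsi Ux; rewrite tmap0 // !addr0.
Qed.

Definition coord (j : 'I_(vrank E)) (u : Sec E) : C :=
  MkCinf (smooth_cutoff cK oU KU chi0 (sec_smooth u Vphi j)).

Lemma coord_lin j (f : C) u v : coord j (f *: u + v) = f * coord j u + coord j v.
Proof.
apply: cf_ext => x /=; have [Ux|/chi_off->] := pselect (tdom phi x).
  by rewrite tmap_lin // !mxE; ring.
by rewrite !mul0r mulr0 addr0.
Qed.

(** Over the domain of [phi] such a vector exists, so the default 0 can matter only where [chi]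
    vanishes. *)
Definition frame_vec (j : 'I_(vrank E)) (x : M) : E x :=
  xget 0 [set v | tmap phi v = delta_mx 0 j].

Lemma tmap_frame_vec j x : tdom phi x -> tmap phi (frame_vec j x) = delta_mx 0 j.
Proof.
move=> Ux; have [_ /(_ x Ux) [_ [g gK Kg]]] := v_triv Vphi.
rewrite /frame_vec; case: xgetP => [v -> //|/(_ (g (delta_mx 0 j)))].
by rewrite /= Kg.
Qed.

Lemma frame_smooth j : smooth_section (fun x => chi x *: frame_vec j x).
Proof.
move=> psi Vpsi i; have [oW _] := v_triv Vpsi.
apply: smooth_fun_local => x Wx.
have [Ux|nUx] := pselect (tdom phi x).
  exists (tdom phi `&` tdom psi) => //.
  have [g [sg gE]] := v_compat Vphi Vpsi.
  have oUW := openI oU oW.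
  apply: (smooth_fun_ext oUW _
    (smooth_funM oUW (smooth_funW oUW (@cf_smooth _ _ chi)) (sg j i))).
  move=> y [Uy Wy]; rewrite tmapZ // mxE gE // tmap_frame_vec //.
  by rewrite -rowE mxE.
exists (~` K `&` tdom psi); first by split => // /KU.
apply: (smooth_fun_ext _ _ (smooth_fun_cst _ 0)).
  by apply: openI => //; rewrite openC.
by move=> y [/chi0 -> Wy]; rewrite scale0r tmap0 // mxE.
Qed.

Definition frame_sec j : Sec E := MkSec (frame_smooth j).

Lemma coord_frame (u : Sec E) :
  \sum_j coord j u *: frame_sec j = (chi * chi) *: u.
Proof.
apply: sec_ext => x; rewrite sec_sumE /=.
have [Ux|nUx] := pselect (tdom phi x); last first.
  rewrite chi_off // mul0r scale0r big1 // => j _.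
  by rewrite mul0r scale0r.
have [_ /(_ x Ux) [_ /bij_inj inj]] := v_triv Vphi; apply: inj.
rewrite (big_morph (tmap phi (x:=x)) (id1 := 0) (op1 := +%R)); first last.
- by rewrite tmap0.
- by move=> a b; rewrite -[a]scale1r tmap_lin // !scale1r.
rewrite tmapZ // [in RHS](row_sum_delta (tmap phi (u x))) scaler_sumr.
apply: eq_bigr => j _; rewrite !tmapZ // tmap_frame_vec // !scalerA.
by congr (_ *: _); ring.
Qed.

Lemma coordZ j (f : C) u : coord j (f *: u) = f * coord j u.
Proof.
have c0 : coord j 0 = 0.
  by have := coord_lin j (-1) 0 0; rewrite scaler0 addr0 mulN1r addNr.
by rewrite -[f *: u]addr0 coord_lin c0 addr0.
Qed.

(** The flat connection of the trivialization. The cutoff enters both the coordinates and the frame,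
    so by [coord_frame] the symbol is [chi]^2 X. *)
Definition local_connection (X : VF M) : DE E.
Proof.
exists (fun u => \sum_j X (coord j u) *: frame_sec j) ((chi * chi) *: X).
- abstract (move=> a u v; rewrite scaler_sumr -big_split /=; apply: eq_bigr => j _;
    by rewrite coord_lin vf_lin scalerDl scalerA).
- abstract (move=> f u; rewrite scaler_sumr /= mulrC -scalerA -coord_frame;
    rewrite scaler_sumr -big_split /=; apply: eq_bigr => j _;
    by rewrite coordZ vf_leib scalerDl !scalerA).
Defined.

End Trivialization.
End LocalFrames.

(** * Global connections by patching *)

Section GlobalConnection.
Variables (R : realType) (M : manifold R).
Local Notation C := (Cinf M).

Lemma countable_plateau_cover (P : C -> Prop) : P 0 ->
  (forall x : M, exists2 psi : C, P psi & \forall y \near x, psi y = 1) ->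
  exists (psi : nat -> C) (V : nat -> set M),
    [/\ forall n, P (psi n), forall n, open (V n),
        forall n y, V n y -> psi n y = 1 & forall x, exists n, V n x].
Proof.
move=> P0 loc; have [B cB [Bo Bx]] := @m_second_countable R M.
have [f finj] := countable_injP _ cB.
(* The injection [f] numbers the countable basis. Index n receives the basis set numbered n when
   some admissible function is 1 on it, and otherwise the empty set with the function 0, admissible
   by [P 0]. *)
pose good n (w : set M * C) :=
  [/\ B w.1, f w.1 = n, P w.2 & forall y, w.1 y -> w.2 y = 1].
have ex n : exists w : set M * C,
    [/\ open w.1, P w.2, forall y, w.1 y -> w.2 y = 1 &
        (exists w', good n w') -> good n w].
  have [[w gw]|no] := pselect (exists w, good n w).
    by exists w; case: (gw) => /Bo.
  by exists (set0, 0); split => //; exact: open0.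
have [w wP] := choice ex.
exists (fun n => (w n).2), (fun n => (w n).1).
split=> [n|n|n|x]; try by case: (wP n).
have [psi Ppsi npsi] := loc x.
have [b [Bb bx] /= sub] := Bx x _ npsi.
exists (f b); have [_ _ _ []] := wP (f b); first by exists (b, psi).
move=> Bw /finj fw _ _; rewrite fw // ?inE //.
Qed.

Variable E : vbundle M.

Lemma local_connection_exists (x : M) :
  exists2 psi : C, (forall X, exists d : DE E, dsym d = psi *: X) &
    \forall y \near x, psi y = 1.
Proof.
have [phi Vphi Ux] := @v_cover R M E x; have [oU _] := v_triv Vphi.
have [chi [nchi [K [cK KU chi0]]]] := bump_function oU Ux.
exists (chi * chi); last by apply: filterS nchi => y /= ->; rewrite mulr1.
by move=> X; exists (local_connection Vphi cK KU chi0 X).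
Qed.

Lemma section_nonvanishing (x : M) : (0 < vrank E)%N ->
  exists e : Sec E, e x <> 0.
Proof.
move=> r0; have [phi Vphi Ux] := @v_cover R M E x; have [oU _] := v_triv Vphi.
have [chi [nchi [K [cK KU chi0]]]] := bump_function oU Ux.
exists (frame_sec Vphi cK KU chi0 (Ordinal r0)) => /= e0.
have := tmap_frame_vec Vphi (Ordinal r0) Ux.
rewrite -[frame_vec _ _ _]scale1r -(nbhs_singleton nchi) e0 tmap0 //.
move=> /matrixP/(_ 0 (Ordinal r0)); rewrite !mxE !eqxx => /eqP.
by rewrite eq_sym oner_eq0.
Qed.

(** What the first n terms of the partition of unity leave of the constant 1. It vanishes wherever
    an earlier [psi m] equals 1, which gives local finiteness. *)
Definition left_over (psi : nat -> C) n : C := \prod_(i < n) (1 - psi i).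

Lemma left_over_sum psi n :
  \sum_(i < n) left_over psi i * psi i = 1 - left_over psi n.
Proof.
elim: n => [|n IH]; first by rewrite big_ord0 /left_over big_ord0 subrr.
rewrite big_ord_recr /= IH /left_over big_ord_recr /=.
by rewrite mulrBr mulr1 opprB addrA [RHS]addrAC.
Qed.

Lemma left_over0 (psi : nat -> C) m n y : (m < n)%N -> psi m y = 1 ->
  left_over psi n y = 0.
Proof.
move=> mn p1; rewrite /left_over (bigD1 (Ordinal mn)) //=.
have e : (1 - psi m) y = 0 by rewrite /= p1; ring.
by apply: (etrans (congr1 (fun a => a * _) e)); rewrite mul0r.
Qed.

Section Patching.
Variables (psi : nat -> C) (V : nat -> set M) (X : VF M) (d : nat -> DE E).
Variable N : M -> nat.
Hypotheses (oV : forall n, open (V n)) (psi1 : forall n y, V n y -> psi n y = 1).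
Hypotheses (dE : forall n, dsym (d n) = psi n *: X) (VN : forall x, V (N x) x).

Definition partial_sum n : DE E := \sum_(i < n) left_over psi i *: d i.

Lemma dsym_sum (I : Type) (r : seq I) (f : I -> DE E) :
  dsym (\sum_(i <- r) f i) = \sum_(i <- r) dsym (f i).
Proof. by apply: (big_morph (@dsym R M E)). Qed.

Lemma dsym_partial_sum n : dsym (partial_sum n) = (1 - left_over psi n) *: X.
Proof.
rewrite dsym_sum -left_over_sum scaler_suml; apply: eq_bigr => i _ /=.
by rewrite dE scalerA.
Qed.

Lemma partial_sum_stable m n u y : V m y -> (m < n)%N ->
  partial_sum n u y = partial_sum m.+1 u y.
Proof.
move=> Vy mn; rewrite -(subnKC mn); elim: (n - m.+1)%N => [|k <-].
  by rewrite addn0.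
rewrite addnS /partial_sum big_ord_recr /=.
by rewrite (left_over0 (m := m)) ?psi1 ?leq_addr // scale0r addr0.
Qed.

Lemma partial_sum_local u x y : V (N x) y ->
  partial_sum (N y).+1 u y = partial_sum (N x).+1 u y.
Proof.
move=> Vy; have [le|/ltnW le] := leqP (N x) (N y).
  exact: partial_sum_stable.
by rewrite [RHS](partial_sum_stable _ (VN y)).
Qed.

(** The sum at x runs through the index [N x] itself, and later terms vanish on [V (N x)]. The
    infinite sum thus coincides on that open set with one fixed partial sum. *)
Lemma patched_smooth u : smooth_section (fun x => partial_sum (N x).+1 u x).
Proof.
move=> phi Vphi j; have [oU _] := v_triv Vphi.
apply: smooth_fun_local => x Ux; exists (V (N x) `&` tdom phi) => //.
have oW := openI (oV (N x)) oU.
apply: (smooth_fun_ext oW _ (smooth_fun_sub (@subIsetr _ _ _)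
  (@sec_smooth _ _ _ (partial_sum (N x).+1 u) phi Vphi j))).
by move=> y [Vy _]; rewrite (partial_sum_local _ Vy).
Qed.

Definition patched_connection : DE E.
Proof.
exists (fun u => MkSec (patched_smooth u)) X.
- abstract by move=> a u v; apply: sec_ext => x /=; rewrite dop_lin.
- abstract (move=> f u; apply: sec_ext => x /=; rewrite dop_leib dsym_partial_sum;
    rewrite /= (left_over0 (m := N x)) ?psi1 //; by rewrite mulr0 addr0 mul1r).
Defined.

End Patching.

Lemma dsym_surjective (X : VF M) : exists d : DE E, dsym d = X.
Proof.
have [|x|psi [V [Ppsi oV psi1 cov]]] := @countable_plateau_cover
    (fun psi => forall X, exists d : DE E, dsym d = psi *: X).
- by move=> Y; exists 0; rewrite scale0r.
- exact: local_connection_exists.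
have [d dE] := choice (fun n => Ppsi n X); have [N VN] := choice cov.
by exists (patched_connection oV psi1 dE VN).
Qed.

Lemma bmap_surjective (t : TE E) : exists Y : omni E, bmap Y = t.
Proof.
case: t => X u; have [d dE] := dsym_surjective X.
by exists (d, jetd u); rewrite /bmap /= dE.
Qed.

End GlobalConnection.

(** * Subbundles of TM (+) E *)

Section Separation.
Variables (R : realType) (M : manifold R) (E : vbundle M).
Local Notation C := (Cinf M).
Local Notation TE := (TE E).
Implicit Types (s t w : TE) (lam mu nu : TE -> C).

Lemma vf0 (X : VF M) : X 0 = 0.
Proof. by have := vf_leib X 0 0; rewrite !mul0r mulr0 addr0. Qed.

Lemma van_TE_lin x (f : C) s t :
  van_TE x s -> van_TE x t -> van_TE x (f *: s + t).
Proof.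
move=> [s1 s2] [t1 t2]; split=> [g|] /=; first by rewrite s1 t1 mulr0 addr0.
by rewrite s2 t2 scaler0 addr0.
Qed.

Lemma van_TE0 x : van_TE x (0 : TE).
Proof. by []. Qed.

Lemma van_TEB x s t : van_TE x s -> van_TE x t -> van_TE x (s - t).
Proof.
by move=> vs vt; rewrite addrC -scaleN1r; exact: van_TE_lin.
Qed.

Lemma van_TED x s t : van_TE x s -> van_TE x t -> van_TE x (s + t).
Proof. by move=> vs vt; rewrite -[s]scale1r; exact: van_TE_lin. Qed.

Lemma van_TEZ x f s : van_TE x s -> van_TE x (f *: s).
Proof. by move=> vs; rewrite -[_ *: _]addr0; exact: van_TE_lin. Qed.

Lemma van_TE_scale0 x (f : C) s : f x = 0 -> van_TE x (f *: s).
Proof. by move=> f0; split=> [g|] /=; rewrite f0 ?mul0r ?scale0r. Qed.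

Lemma van_TE_sum x (I : Type) (r : seq I) (F : I -> TE) :
  (forall i, van_TE x (F i)) -> van_TE x (\sum_(i <- r) F i).
Proof.
by move=> v; elim/big_ind: _ => // *; exact: van_TED.
Qed.

Lemma van_TE_eq0 s : (forall x, van_TE x s) -> s = 0.
Proof.
move=> v; rewrite [s]surjective_pairing; congr pair.
  by apply: vf_ext => f; apply: cf_ext => x; have [] := v x.
by apply: sec_ext => x; have [] := v x.
Qed.

(** The second clause says that the functional acts on values at points. It is imposed here, since
    deducing it from linearity would take a local frame of TM. *)
Definition tensorial lam :=
  (forall (f : C) s t, lam (f *: s + t) = f * lam s + lam t) /\
  (forall x t, van_TE x t -> lam t x = 0).

Section Tensorial.
Variables (lam : TE -> C) (tl : tensorial lam).

Lemma tensorial0 : lam 0 = 0.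
Proof. by apply: cf_ext => x; have [_ ->] := tl. Qed.

Lemma tensorialZ f s : lam (f *: s) = f * lam s.
Proof. by have [l _] := tl; rewrite -[_ *: _]addr0 l tensorial0 addr0. Qed.

Lemma tensorialD s t : lam (s + t) = lam s + lam t.
Proof. by have [l _] := tl; rewrite -[s]scale1r l mul1r scale1r. Qed.

Lemma tensorialB s t : lam (s - t) = lam s - lam t.
Proof. by rewrite tensorialD -[- t]scaleN1r tensorialZ mulN1r. Qed.

Lemma tensorial_sum (I : Type) (r : seq I) (F : I -> TE) :
  lam (\sum_(i <- r) F i) = \sum_(i <- r) lam (F i).
Proof. by apply: (big_morph lam); [exact: tensorialD|exact: tensorial0]. Qed.

Lemma tensorial_comb (I : Type) (r : seq I) (c : I -> R) (v : I -> TE) x :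
  lam (\sum_(i <- r) cst_cf M (c i) *: v i) x =
  \sum_(i <- r) c i * lam (v i) x.
Proof.
by rewrite tensorial_sum cf_sumE; apply: eq_bigr => i _; rewrite tensorialZ.
Qed.

Lemma tensorial_van x s t : van_TE x (s - t) -> lam s x = lam t x.
Proof.
have [_ v] := tl => /v; rewrite tensorialB /= mulN1r => /eqP.
by rewrite subr_eq0 => /eqP.
Qed.

End Tensorial.

Lemma tensorial_cross lam mu (f g : C) : tensorial lam -> tensorial mu ->
  tensorial (fun s => f * lam s - g * mu s).
Proof.
move=> tl tm; split=> [h s t|x t vt].
  rewrite !tensorialD // !tensorialZ //; apply: cf_ext => x /=; ring.
by have [[_ l] [_ m]] := (tl, tm); rewrite /= l // m // !mulr0 addr0.
Qed.

Lemma tensorial_separates x t : ~ van_TE x t ->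
  exists2 lam, tensorial lam & lam t x != 0.
Proof.
move=> nv; have [[f tf]|no] := pselect (exists f, t.1 f x != 0).
  by exists (fun s => s.1 f) => //; split=> [//|y s []].
have nt2 : t.2 x <> 0.
  move=> t20; apply: nv; split=> // f; apply/eqP/negPn/negP => tf.
  by apply: no; exists f.
have [phi Vphi Ux] := @v_cover R M E x; have [oU _] := v_triv Vphi.
have [chi [nchi [K [cK KU chi0]]]] := bump_function oU Ux.
have chix : chi x = 1 by exact: nbhs_singleton nchi.
have [j tj] : exists j, tmap phi (t.2 x) 0 j != 0.
  apply/not_existsP => al; apply: nt2.
  have [_ /(_ x Ux) [_ /bij_inj inj]] := v_triv Vphi; apply: inj.
  rewrite tmap0 //; apply/rowP => j; rewrite mxE.
  by apply/eqP/negPn/negP; exact: al.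
exists (fun s => coord Vphi cK KU chi0 j s.2); last by rewrite /= chix mul1r.
split=> [f s s'|y s [_ s0]]; first exact: coord_lin.
rewrite /=; have [Uy|nUy] := pselect (tdom phi y).
  by rewrite s0 tmap0 // mxE mulr0.
by rewrite chi0 ?mul0r // => /KU.
Qed.

(** Gaussian elimination by induction on [r]. Cross multiplication replaces division, so the
    functional kills each [v i] on all of M and not only at x. *)
Lemma tensorial_separates_family (I : eqType) (v : I -> TE) (r : seq I) x w :
  uniq r ->
  (forall c : I -> R, van_TE x (\sum_(i <- r) cst_cf M (c i) *: v i) ->
     forall i, i \in r -> c i = 0) ->
  (forall c : I -> R,
     ~ van_TE x (w - \sum_(i <- r) cst_cf M (c i) *: v i)) ->
  exists lam, [/\ tensorial lam, forall i, i \in r -> lam (v i) = 0 &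
    lam w x != 0].
Proof.
elim: r w => [|j r IH] w /=.
  move=> _ _ /(_ (fun=> 0)); rewrite big_nil subr0 => /tensorial_separates.
  by move=> [lam tl lw]; exists lam.
move=> /andP[jr ur] ind nspan.
have big_upd (c : I -> R) a :
    \sum_(i <- r) cst_cf M (if i == j then a else c i) *: v i =
    \sum_(i <- r) cst_cf M (c i) *: v i.
  rewrite big_seq [RHS]big_seq; apply: eq_bigr => i ir; case: eqP => // ij.
  by rewrite -ij ir in jr.
have indr c : van_TE x (\sum_(i <- r) cst_cf M (c i) *: v i) ->
    forall i, i \in r -> c i = 0.
  move=> vc i ir; have := ind (fun i => if i == j then 0 else c i).
  rewrite big_cons eqxx big_upd => /(_ _ i).
  have -> : cst_cf M 0 *: v j = 0 by rewrite -(scale0r (v j)).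
  rewrite add0r inE ir orbT => /(_ vc isT).
  by case: eqP => // ij; rewrite -ij ir in jr.
have [|mu [tm mu0 muj]] := IH (v j) ur indr.
  move=> c vc; have := ind (fun i => if i == j then 1 else - c i).
  rewrite big_cons eqxx big_upd => /(_ _ j).
  rewrite inE eqxx /= => h; have : (1 : R) = 0.
    apply: h => //; congr (van_TE x _): vc; congr (_ + _).
      by rewrite -[LHS]scale1r.
    rewrite -sumrN; apply: eq_bigr => i _; rewrite -scaleNr; congr (_ *: _).
    by apply: cf_ext => y /=; rewrite mulN1r.
  by move/eqP; rewrite oner_eq0.
(* With this constant [mu] vanishes at x on [w - c0 v_j]. The cross combination of [mu] and [nu]
   then takes at [w] the value [mu (v j)] times [nu] of that difference. *)
pose c0 := mu w x / mu (v j) x.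
have [|nu [tn nu0 nuw]] := IH (w - cst_cf M c0 *: v j) ur indr.
  move=> c vc; apply: (nspan (fun i => if i == j then c0 else c i)).
  by rewrite big_cons eqxx big_upd opprD addrA.
exists (fun s => mu (v j) * nu s - nu (v j) * mu s); split.
- exact: tensorial_cross.
- move=> i; rewrite inE => /orP[/eqP->|ir]; first by rewrite mulrC subrr.
  by rewrite (mu0 i ir) (nu0 i ir) !mulr0 subrr.
have -> : (mu (v j) * nu w - nu (v j) * mu w) x =
    mu (v j) x * nu (w - cst_cf M c0 *: v j) x.
  rewrite tensorialB // tensorialZ //= /c0; field; exact: muj.
by rewrite mulf_neq0.
Qed.

End Separation.

(** * Double annihilators and local lifting in a subbundle *)

Section SubbundlesOfTE.
Variables (R : realType) (M : manifold R) (E : vbundle M).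
Local Notation C := (Cinf M).
Local Notation TE := (TE E).
Implicit Types (A S : set TE).

Definition comb k (c : 'I_k -> R) (v : 'I_k -> TE) : TE :=
  \sum_(i < k) cst_cf M (c i) *: v i.

Lemma same_value_sym x (s t : TE) :
  same_value (@van_TE _ _ E) x s t -> same_value (@van_TE _ _ E) x t s.
Proof.
by rewrite /same_value => v; rewrite -opprB -scaleN1r; exact: van_TEZ.
Qed.

Lemma same_value_trans x (s t w : TE) : same_value (@van_TE _ _ E) x s t ->
  same_value (@van_TE _ _ E) x t w -> same_value (@van_TE _ _ E) x s w.
Proof. by move=> st tw; have := van_TED st tw; rewrite addrA subrK. Qed.

Lemma comb_same_value x k c (v w : 'I_k -> TE) :
  (forall i, same_value (@van_TE _ _ E) x (v i) (w i)) ->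
  same_value (@van_TE _ _ E) x (comb c v) (comb c w).
Proof.
move=> vw; rewrite /same_value -sumrB; apply: van_TE_sum => i.
by rewrite -scalerBr; exact: (van_TEZ _ (vw i)).
Qed.

Lemma comb_comb k (c : 'rV[R]_k) (N : 'M[R]_k) (v : 'I_k -> TE) :
  comb (c 0) (fun j => comb (N j) v) = comb ((c *m N) 0) v.
Proof.
rewrite /comb; under eq_bigr do rewrite scaler_sumr.
rewrite exchange_big /=; apply: eq_bigr => i _.
under eq_bigr do rewrite scalerA.
rewrite -scaler_suml mxE; congr (_ *: _); apply: cf_ext => y.
by rewrite cf_sumE.
Qed.

(** The square matrix that expresses [e] in the frame [f] has zero left kernel, so it is invertible
    and [e] spans the fibre too. *)
Lemma frame_of_independent A k (f e : 'I_k -> TE) y :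
  frame_at (@van_TE _ _ E) A f y -> (forall i, A (e i)) ->
  (forall c : 'I_k -> R, van_TE y (comb c e) -> forall i, c i = 0) ->
  frame_at (@van_TE _ _ E) A e y.
Proof.
move=> [Af find fspan] Ae eind; split=> // a Aa.
have [N Ne] := choice (fun j => fspan _ (Ae j)).
pose N' := \matrix_(j, i) N j i.
have eN j : same_value (@van_TE _ _ E) y (e j) (comb (N' j) f).
  rewrite (_ : comb (N' j) f = comb (N j) f); first exact: Ne.
  by apply: eq_bigr => i _; rewrite mxE.
have combE (c : 'rV[R]_k) :
    same_value (@van_TE _ _ E) y (comb (c 0) e) (comb ((c *m N') 0) f).
  by rewrite -comb_comb; exact: comb_same_value.
have N'unit : N' \in unitmx.
  rewrite -row_free_unit -kermx_eq0; apply/eqP/row_matrixP => i.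
  rewrite row0; apply/rowP => j; rewrite [RHS]mxE.
  apply: (eind (row i (kermx N') 0)).
  have := combE (row i (kermx N')).
  rewrite -row_mul mulmx_ker row0 /same_value [X in _ - X]big1 ?subr0 // => l _.
  by rewrite mxE -(scale0r (f l)).
have [d ad] := fspan a Aa; pose d' : 'rV[R]_k := \row_i d i.
exists ((d' *m invmx N') 0); apply: (same_value_trans (t := comb d f)) => //.
apply: same_value_sym; have := combE (d' *m invmx N').
rewrite mulmxKV // (_ : comb (d' 0) f = comb d f) //.
by apply: eq_bigr => i _; rewrite mxE.
Qed.

(** The tensor product of [lam] and [e], split along gl(E) (+) Hom(TM, E). *)
Lemma hom_of_tensorial (lam : TE -> C) (e : Sec E) : tensorial lam ->
  exists (phi : DE E) (y : HomTE E),
    dsym phi = 0 /\ forall t : TE, phi t.2 + y t.1 = lam t *: e.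
Proof.
move=> tl.
have phi_lin (a : R) (u v : Sec E) : lam (0, cst_cf M a *: u + v) *: e =
    cst_cf M a *: (lam (0, u) *: e) + lam (0, v) *: e.
  have [l _] := tl; have := l (cst_cf M a) (0, u) (0, v).
  rewrite scalerA -scalerDl => <-; congr (lam _ *: _).
  by congr pair; rewrite /= scaler0 addr0.
have phi_leib (f : C) (u : Sec E) : lam (0, f *: u) *: e =
    f *: (lam (0, u) *: e) + (0 : VF M) f *: u.
  rewrite scale0r addr0 scalerA -tensorialZ //; congr (lam _ *: _).
  by congr pair; rewrite /= scaler0.
have y_lin (f : C) (X Y : VF M) : lam (f *: X + Y, 0) *: e =
    f *: (lam (X, 0) *: e) + lam (Y, 0) *: e.
  have [l _] := tl; have := l f (X, 0) (Y, 0).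
  rewrite scalerA -scalerDl => <-; congr (lam _ *: _).
  by congr pair; rewrite /= scaler0 addr0.
exists (MkDE phi_lin phi_leib), (MkHomTE y_lin); split=> // -[X u] /=.
rewrite -scalerDl -tensorialD //; congr (lam _ *: _).
by congr pair; rewrite /= ?add0r ?addr0.
Qed.

Lemma mem_sub_comb A k (c : 'I_k -> R) (e : 'I_k -> TE) n :
  subbundle (@van_TE _ _ E) n A -> (forall i, A (e i)) -> A (comb c e).
Proof.
move=> [A0 Al _ _] Ae; rewrite /comb; elim: (index_enum _) => [|i r IH].
  by rewrite big_nil.
by rewrite big_cons; exact: Al.
Qed.

(** If [t] leaves the fibre of [A] at x, some functional kills a local frame of [A] but not [t] at
    x. Cut off inside the domain of the frame, it kills all of [A]; tensored with a section of E
    that is nonzero at x, it contradicts the assumption. *)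
Lemma mem_of_annihilators A k t : (0 < vrank E)%N ->
  subbundle (@van_TE _ _ E) k A ->
  (forall (phi : DE E) (y : HomTE E), dsym phi = 0 ->
     (forall a, A a -> phi a.2 + y a.1 = 0) -> phi t.2 + y t.1 = 0) -> A t.
Proof.
move=> r0 sA ann; have [A0 Al Aloc Afr] := sA; apply: Aloc => x.
have [U [oU Ux [e eU]]] := Afr x; have [Ae eind _] := eU x Ux.
apply/not_notP => nt.
have [||lam [tl lam0 lamt]] := @tensorial_separates_family R M E _ e
    (index_enum 'I_k) x t (index_enum_uniq _).
- by move=> c vc i _; exact: eind vc i.
- by move=> c vc; apply: nt; exists (comb c e) => //; exact: mem_sub_comb sA Ae.
have [chi [nchi [K [_ KU chi0]]]] := bump_function oU Ux.
have chix : chi x = 1 by exact: nbhs_singleton nchi.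
have tl' : tensorial (fun s => chi * lam s).
  split=> [f s s'|y s vs]; first by rewrite (proj1 tl) mulrDr mulrCA.
  by rewrite /= (proj2 tl) // mulr0.
have [e0 e0x] := section_nonvanishing x r0.
have [phi [y [phi0 phiE]]] := hom_of_tensorial e0 tl'.
have kills a : A a -> chi * lam a = 0.
  move=> Aa; apply: cf_ext => z /=.
  have [Uz|nUz] := pselect (U z); last by rewrite chi0 ?mul0r // => /KU.
  have [_ _ spn] := eU z Uz; have [c ac] := spn a Aa.
  rewrite (tensorial_van tl ac) (tensorial_comb tl) big1 ?mulr0 // => i _.
  by rewrite lam0 ?mem_index_enum // mulr0.
have : phi t.2 + y t.1 = 0.
  by apply: ann => // a Aa; rewrite phiE kills // scale0r.
rewrite phiE => /(congr1 (fun s : Sec E => s x)) /= /eqP.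
by rewrite chix mul1r scaler_eq0 (negbTE lamt) /= => /eqP.
Qed.

(** [S] will be b(L), whose values fill the fibres of [A] although sections of [A] need not lift
    globally. This is Cramer's rule: with [e] in [S] agreeing at x with a frame and [lam j] killing
    every other [e i], the numbers lam_j(a)/lam_j(e_j) are the coordinates of a, and [Del] clears
    the denominators. *)
Lemma local_lift A S k (x : M) : subbundle (@van_TE _ _ E) k A ->
  S 0 -> (forall (f : C) s t, S s -> S t -> S (f *: s + t)) ->
  S `<=` A -> (forall a y, A a -> in_fibre (@van_TE _ _ E) S y a) ->
  exists2 Del : C, Del x != 0 & forall a, A a -> S (Del *: a).
Proof.
move=> sA S0 Sl SA AS; have [A0 Al Aloc Afr] := sA.
have [U [oU Ux [f fU]]] := Afr x; have [Af find _] := fU x Ux.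
have [e eS fe] : exists2 e : 'I_k -> TE, forall i, S (e i) &
    forall i, same_value (@van_TE _ _ E) x (f i) (e i).
  have /choice[e eP] : forall i, exists s,
      S s /\ same_value (@van_TE _ _ E) x (f i) s.
    by move=> i; have [s] := AS (f i) x (Af i); exists s.
  by exists e => i; have [] := eP i.
have eind (c : 'I_k -> R) : van_TE x (comb c e) -> forall i, c i = 0.
  move=> vc; apply: find; have := @comb_same_value x k c f e fe.
  by move=> /van_TED/(_ vc); rewrite subrK.
have lamP j : exists lam : TE -> C, [/\ tensorial lam,
    forall i, i != j -> lam (e i) = 0 & lam (e j) x != 0].
  have [|c|c|lam [tl l0 lj]] := @tensorial_separates_family R M E _ e
    [seq i <- index_enum 'I_k | i != j] x (e j).
  - by rewrite filter_uniq // index_enum_uniq.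
  - rewrite big_filter => vc i; rewrite mem_filter => /andP[ij _].
    have := eind (fun i => if i == j then 0 else c i) _ i.
    rewrite (negbTE ij); apply; congr (van_TE x _): vc.
    rewrite [RHS](bigD1 j) //= eqxx.
    have -> : cst_cf M 0 *: e j = 0 by rewrite -(scale0r (e j)).
    rewrite add0r.
    by apply: eq_bigr => l /negbTE ->.
  - rewrite big_filter => vc.
    have := eind (fun i => if i == j then 1 else - c i) _ j.
    rewrite eqxx => h; have /eqP : (1 : R) = 0; last by rewrite oner_eq0.
    apply: h; congr (van_TE x _): vc; rewrite [RHS](bigD1 j) //= eqxx.
    congr (_ + _); first by rewrite -[LHS]scale1r.
    rewrite -sumrN; apply: eq_bigr => l /negbTE ->; rewrite -scaleNr.
    congr (_ *: _).
    by apply: cf_ext => y /=; rewrite mulN1r.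
  exists lam; split=> // i ij; apply: l0; rewrite mem_filter ij.
  exact: mem_index_enum.
have [lam lamE] := choice lamP.
have tl j : tensorial (lam j) by have [] := lamE j.
have lam0 i j : i != j -> lam j (e i) = 0 by have [_ h _] := lamE j; exact: h.
pose D : C := \prod_j lam j (e j).
pose D' j : C := \prod_(i | i != j) lam i (e i).
have DD' j : D = lam j (e j) * D' j by rewrite /D (bigD1 j).
have cf_prodE (I : finType) (P : pred I) (F : I -> C) y :
    (\prod_(i | P i) F i) y = \prod_(i | P i) F i y.
  by apply: (big_morph (fun g : C => g y)).
(* One factor [D] clears the denominators; the other makes both sides of the expansion vanish where
   [D] is zero and [e] may fail to be a frame. *)
exists (D * D).
  rewrite /= cf_prodE mulf_neq0 //; apply/prodf_neq0 => j _; by have [] := lamE j.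
move=> a Aa.
suff -> : (D * D) *: a = \sum_j (D * D' j * lam j a) *: e j.
  elim: (index_enum _) => [|i r IH]; first by rewrite big_nil.
  by rewrite big_cons; apply: Sl.
apply/eqP; rewrite -subr_eq0; apply/eqP; apply: van_TE_eq0 => y.
have [D0|Dn0] := eqVneq (D y) 0.
  apply: van_TEB; first by apply: van_TE_scale0; rewrite /= D0 mul0r.
  by apply: van_TE_sum => j; apply: van_TE_scale0; rewrite /= D0 !mul0r.
have le0 j : lam j (e j) y != 0.
  by apply: contraNneq Dn0 => l0; rewrite (DD' j) /= l0 mul0r.
have lam_comb j c : lam j (comb c e) y = c j * lam j (e j) y.
  rewrite (tensorial_comb (tl j)) (bigD1 j) //= big1 ?addr0 // => i ij.
  by rewrite lam0 // mulr0.
have [U' [_ U'y [f' f'U]]] := Afr y.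
have [|c vc|_ _ spn] := frame_of_independent (e := e) (f'U y U'y).
- by move=> i; exact: SA.
- move=> j; have := lam_comb j c; rewrite (proj2 (tl j)) // => /esym/eqP.
  by rewrite mulf_eq0 (negbTE (le0 j)) orbF => /eqP.
have [c ac] := spn a Aa.
have cE j : lam j a y = c j * lam j (e j) y.
  by rewrite -lam_comb; exact: tensorial_van.
apply: (same_value_trans (t := (D * D) *: comb c e)).
  by rewrite /same_value -scalerBr; exact: van_TEZ.
rewrite /same_value /comb scaler_sumr -sumrB; apply: van_TE_sum => j.
rewrite scalerA -scalerBl; apply: van_TE_scale0.
rewrite /= cE {1}(DD' j) /=; ring.
Qed.

End SubbundlesOfTE.

(** * Identities in abelian groups *)

Section AbelianGroupNormalForm.

(** Syntax for the reflexive tactic [zmod]: two expressions agree in every abelian group when each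
    atom has the same integer coefficient in both. *)
Inductive zmod_expr :=
  | ZAtom of nat
  | ZZero
  | ZAdd of zmod_expr & zmod_expr
  | ZOpp of zmod_expr.

Fixpoint zmod_eval (V : zmodType) (env : seq V) (e : zmod_expr) : V :=
  match e with
  | ZAtom i => nth 0 env i
  | ZZero => 0
  | ZAdd e1 e2 => zmod_eval env e1 + zmod_eval env e2
  | ZOpp e1 => - zmod_eval env e1
  end.

Fixpoint zmod_coef (e : zmod_expr) (i : nat) : int :=
  match e with
  | ZAtom j => (i == j)%:Z
  | ZZero => 0
  | ZAdd e1 e2 => zmod_coef e1 i + zmod_coef e2 i
  | ZOpp e1 => - zmod_coef e1 i
  end.

Lemma zmod_eval_sum (V : zmodType) (env : seq V) e :
  zmod_eval env e = \sum_(i < size env) nth 0 env i *~ zmod_coef e i.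
Proof.
elim: e => [j||e1 IH1 e2 IH2|e1 IH1] /=.
- have [lt|ge] := ltnP j (size env).
    rewrite (bigD1 (Ordinal lt)) //= eqxx mulr1z big1 ?addr0 // => i.
    by rewrite -val_eqE /= => /negbTE ->; rewrite mulr0z.
  rewrite nth_default // big1 // => i _.
  by rewrite ltn_eqF ?mulr0z // (leq_trans (ltn_ord i)).
- by rewrite big1 // => i _; rewrite mulr0z.
- by rewrite IH1 IH2 -big_split; apply: eq_bigr => i _; rewrite mulrzDr.
- by rewrite IH1 -sumrN; apply: eq_bigr => i _; rewrite mulrNz.
Qed.

Lemma zmod_evalP (V : zmodType) (env : seq V) e1 e2 :
  all (fun i => zmod_coef e1 i == zmod_coef e2 i) (iota 0 (size env)) ->
  zmod_eval env e1 = zmod_eval env e2.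
Proof.
move=> /allP eq12; rewrite !zmod_eval_sum; apply: eq_bigr => i _.
by rewrite (eqP (eq12 i _)) // mem_iota ltn_ord.
Qed.

End AbelianGroupNormalForm.

(* Atoms are compared up to conversion, because the module structures on the
   same type may have been inferred along different instance paths. *)
Ltac zmod_index a env :=
  lazymatch env with
  | ?b :: ?env' =>
      match goal with
      | _ => let _ := match goal with _ => unify a b end in constr:(0%N)
      | _ => let i := zmod_index a env' in constr:(i.+1)
      end
  end.

Ltac zmod_atoms t env :=
  lazymatch t with
  | (?a + ?b)%R => let env := zmod_atoms a env in zmod_atoms b env
  | (- ?a)%R => zmod_atoms a env
  | 0%R => env
  | _ => match goal with
         | _ => let _ := zmod_index t env in env
         | _ => constr:(t :: env)
         end
  end.

Ltac zmod_reify t env :=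
  lazymatch t with
  | (?a + ?b)%R =>
      let a := zmod_reify a env in
      let b := zmod_reify b env in constr:(ZAdd a b)
  | (- ?a)%R => let a := zmod_reify a env in constr:(ZOpp a)
  | 0%R => constr:(ZZero)
  | _ => let i := zmod_index t env in constr:(ZAtom i)
  end.

Ltac zmod :=
  lazymatch goal with
  | |- @eq ?T ?s ?t =>
      let env := zmod_atoms s (@nil T) in
      let env := zmod_atoms t env in
      let es := zmod_reify s env in
      let et := zmod_reify t env in
      refine (@zmod_evalP _ env es et _); vm_compute; reflexivity
  end.

(** * The omni-Lie algebroid *)

Section OmniLieAlgebra.
Variables (R : realType) (M : manifold R) (E : vbundle M).
Local Notation C := (Cinf M).
Local Notation omni := (omni E).
Implicit Types (X Y Z : omni) (f : C).

Lemma cst_cfN1 : cst_cf M (-1) = -1.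
Proof. by apply: cf_ext => x /=; ring. Qed.

Lemma scaler_cstN1 (u : Sec E) : cst_cf M (-1) *: u = - u.
Proof. by rewrite cst_cfN1 scaleN1r. Qed.

Lemma dopN (d : DE E) u : d (- u) = - d u.
Proof.
by have := dop_lin d (-1) u 0; rewrite dop0 !addr0 !scaler_cstN1.
Qed.

Lemma jetD (m : JE E) d r : m (d + r) = m d + m r.
Proof. by have := jet_lin m 1 d r; rewrite !scale1r. Qed.

Lemma jetN (m : JE E) d : m (- d) = - m d.
Proof. by have := jet_lin m (-1) d 0; rewrite jet0 !addr0 !scaleN1r. Qed.

Lemma lie_vfC (V W : VF M) : lie_vf V W = - lie_vf W V.
Proof.
by apply: vf_ext => f; apply: cf_ext => x /=; ring.
Qed.

Lemma lie_deC (d r : DE E) : lie_de d r = - lie_de r d.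
Proof.
apply: de_ext => [u|] /=; last by rewrite lie_vfC -scaleN1r.
by rewrite scaleN1r opprB.
Qed.

Lemma lie_vfD (V W W' : VF M) : lie_vf V (W + W') = lie_vf V W + lie_vf V W'.
Proof.
by apply: vf_ext => f; apply: cf_ext => x /=; rewrite vfD /=; ring.
Qed.

Lemma lie_vfZ (V W : VF M) f : lie_vf V (f *: W) = f *: lie_vf V W + V f *: W.
Proof.
by apply: vf_ext => g; apply: cf_ext => x /=; rewrite vf_leib /=; ring.
Qed.

Lemma lie_vf_jacobi (V W W' : VF M) :
  lie_vf V (lie_vf W W') = lie_vf (lie_vf V W) W' + lie_vf W (lie_vf V W').
Proof.
have vfB (X : VF M) f g : X (f - g) = X f - X g.
  rewrite vfD -mulN1r; have := vf_lin X (-1) g 0.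
  by rewrite !addr0 vf0 addr0 cst_cfN1 mulN1r => ->; rewrite mulN1r.
by apply: vf_ext => f; rewrite /= !vfB; zmod.
Qed.

Lemma bmapD X Y : bmap (X + Y) = bmap X + bmap Y.
Proof. by []. Qed.

Lemma bmapZ f X : bmap (f *: X) = f *: bmap X.
Proof. by []. Qed.

Lemma bmapN X : bmap (- X) = - bmap X.
Proof. by rewrite -[- X]scaleN1r bmapZ scaleN1r. Qed.

Lemma bmap_dorfman X Y : bmap (dorfman X Y) =
  (lie_vf (dsym X.1) (dsym Y.1),
   X.1 (jet_proj Y.2) - Y.1 (jet_proj X.2) + X.2 Y.1).
Proof.
congr pair; rewrite /jet_proj /= !lie_de_id !jet0 subr0.
by rewrite scaleN1r subr0.
Qed.

Lemma bmap_dorfmanZ X Y f : bmap (dorfman X (f *: Y)) =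
  f *: bmap (dorfman X Y) + dsym X.1 f *: bmap Y.
Proof.
rewrite !bmap_dorfman; congr pair; first exact: lie_vfZ.
rewrite /jet_proj /= dop_leib.
have -> : X.2 (f *: Y.1) = f *: X.2 Y.1.
  by have := jet_lin X.2 f Y.1 0; rewrite jet0 !addr0.
rewrite !scalerDr scalerN /jet_proj; zmod.
Qed.

Lemma bmap_dorfmanD X Y Z : bmap (dorfman X (Y + Z)) =
  bmap (dorfman X Y) + bmap (dorfman X Z).
Proof.
rewrite !bmap_dorfman; congr pair; first exact: lie_vfD.
rewrite /jet_proj /= dopD jetD; zmod.
Qed.

(** As [Y.1] lies in gl(E), the relation [jet_gl] turns X.2(Y.1) into Y.1(p(X.2)), which cancels the
    middle term. Hence [falling] is well defined. *)
Lemma bmap_dorfman_ker X Y : bmap Y = 0 -> bmap (dorfman X Y) = 0.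
Proof.
move=> [Y1 Y2]; rewrite bmap_dorfman Y1 lie_vf0; congr pair.
by rewrite Y2 dop0 jet_gl // sub0r addrC subrr.
Qed.

Lemma bmap_dorfman_congr X Y Z : bmap Y = bmap Z ->
  bmap (dorfman X Y) = bmap (dorfman X Z).
Proof.
move=> YZ; rewrite -[Y](subrK Z) bmap_dorfmanD bmap_dorfman_ker ?add0r //.
by rewrite bmapD bmapN YZ subrr.
Qed.

Lemma bmap_dorfman_jacobi X Y Z : bmap (dorfman X (dorfman Y Z)) =
  bmap (dorfman (dorfman X Y) Z) + bmap (dorfman Y (dorfman X Z)).
Proof.
rewrite !bmap_dorfman; congr pair; first exact: lie_vf_jacobi.
have p (A B : omni) : jet_proj (dorfman A B).2 =
    A.1 (jet_proj B.2) - B.1 (jet_proj A.2) + A.2 B.1.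
  exact: (congr1 (fun t : TE E => t.2) (bmap_dorfman A B)).
rewrite !p /= !(dopD, dopN) !scaleN1r; zmod.
Qed.

Lemma pairingC X Y : pairing X Y = pairing Y X.
Proof. by congr (_ *: _); exact: addrC. Qed.

Lemma pairingDr X Y Z : pairing X (Y + Z) = pairing X Y + pairing X Z.
Proof. by rewrite /pairing -scalerDr /= jetD; congr (_ *: _); zmod. Qed.

Lemma pairingZr X Y f : pairing X (f *: Y) = f *: pairing X Y.
Proof.
have jZ : X.2 (f *: Y.1) = f *: X.2 Y.1.
  by have := jet_lin X.2 f Y.1 0; rewrite jet0 !addr0.
by rewrite /pairing scalerA [f * _]mulrC -scalerA !scalerDr /= jZ.
Qed.

Lemma pairingNr X Y : pairing X (- Y) = - pairing X Y.
Proof. by rewrite -scaleN1r pairingZr scaleN1r. Qed.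

(** Identities for the pairing are proved for its double, free of the factor 1/2, and recovered by
    [double_inj]. *)
Lemma pairing_double X Y : pairing X Y + pairing X Y = Y.2 X.1 + X.2 Y.1.
Proof.
rewrite /pairing -scalerDl (_ : Defs.half M + Defs.half M = 1) ?scale1r //.
by apply: cf_ext => x /=; field.
Qed.

Lemma double_inj (u v : Sec E) : u + u = v + v -> u = v.
Proof.
have half2 w : Defs.half M *: (w + w) = w :> Sec E.
  rewrite scalerDr -scalerDl (_ : Defs.half M + Defs.half M = 1) ?scale1r //.
  by apply: cf_ext => x /=; field.
by move=> /(congr1 (fun w => Defs.half M *: w)); rewrite !half2.
Qed.

Lemma pairing_invariant X Y Z :
  X.1 (pairing Y Z) = pairing (dorfman X Y) Z + pairing Y (dorfman X Z).
Proof.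
apply: double_inj; rewrite -dopD pairing_double addrACA !pairing_double.
rewrite /= !(dopD, dopN) !scaleN1r (lie_deC Z.1 Y.1) jetN; zmod.
Qed.

Lemma dorfmanC X Y : dorfman Y X =
  - dorfman X Y + (0, jetd (pairing X Y + pairing X Y)).
Proof.
rewrite [LHS]surjective_pairing [RHS]surjective_pairing; congr pair.
  by rewrite /= addr0 lie_deC -[- _]scaleN1r.
rewrite pairing_double; apply: jet_ext => d.
by rewrite /= !dopD !scaleN1r; zmod.
Qed.

Lemma bmap_dorfmanC X Y : bmap (dorfman Y X) =
  - bmap (dorfman X Y) + Defs.inE (pairing X Y + pairing X Y).
Proof. by rewrite dorfmanC bmapD bmapN. Qed.

Lemma pairing_jetd u X :
  pairing (0, jetd u) X + pairing (0, jetd u) X = X.1 u.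
Proof. by rewrite pairing_double /= jet0 add0r. Qed.

Lemma falling_bmap X Y : falling X (bmap Y) = bmap (dorfman X Y).
Proof.
apply: bmap_dorfman_congr.
by apply: (@xgetPex _ (0 : omni) [set Z | bmap Z = bmap Y]); exists Y.
Qed.

Lemma fallingD X s t : falling X (s + t) = falling X s + falling X t.
Proof.
have [[Y <-] [Z <-]] := (bmap_surjective s, bmap_surjective t).
by rewrite -bmapD !falling_bmap bmap_dorfmanD.
Qed.

Lemma fallingN X t : falling X (- t) = - falling X t.
Proof.
have f0 : falling X 0 = 0.
  by rewrite (falling_bmap X 0) (bmap_dorfman_ker X (Y := 0)).
by apply/eqP; rewrite -addr_eq0 -fallingD addNr f0.
Qed.

Lemma fallingZ X f t : falling X (f *: t) = f *: falling X t + dsym X.1 f *: t.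
Proof.
have [Y <-] := bmap_surjective t.
by rewrite -bmapZ !falling_bmap bmap_dorfmanZ.
Qed.

Lemma falling_anchor X t : (falling X t).1 = lie_vf (dsym X.1) t.1.
Proof. by have [Y <-] := bmap_surjective t; rewrite falling_bmap bmap_dorfman. Qed.

(** Invariance expands l1(X, l2). Exchanging the arguments of {l1, X} adds the jet of 2(X, l1),
    whose pairing with [l2] is l2(X, l1) and cancels the second term of the coboundary. *)
Lemma coboundary_pairing X l1 l2 :
  coboundary (cochain X) l1 l2 = - pairing (dorfman X l1) l2.
Proof.
rewrite /coboundary /cochain pairing_invariant.
rewrite (dorfmanC X l1) [pairing (_ + _) _]pairingC pairingDr pairingNr.
rewrite ![pairing l2 _]pairingC.
have -> : pairing (0, jetd (pairing X l1 + pairing X l1)) l2 = l2.1 (pairing X l1).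
  by apply: double_inj; rewrite pairing_jetd dopD.
zmod.
Qed.

End OmniLieAlgebra.

(** * Nijenhuis deformations of a Lie algebra *)

Section NijenhuisTorsion.
Variables (V : zmodType) (S : V -> Prop) (br : V -> V -> V) (N : V -> V).
Hypotheses (SD : forall a b, S a -> S b -> S (a + b)).
Hypotheses (SN : forall a, S a -> S (- a)).
Hypotheses (Sbr : forall a b, S a -> S b -> S (br a b)).
Hypotheses (SNij : forall a, S a -> S (N a)).
Hypotheses (brD : forall a b c, S a -> S b -> S c ->
  br (a + b) c = br a c + br b c).
Hypotheses (ND : forall a b, S a -> S b -> N (a + b) = N a + N b).
Hypotheses (jacobi : forall a b c, S a -> S b -> S c ->
  br (br a b) c + br (br b c) a + br (br c a) b = 0).

Definition deformed (a b : V) : V := br (N a) b + br a (N b) - N (br a b).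

(** The negative of the usual Nijenhuis torsion of [N], with the sign of T^X. *)
Definition nijenhuis (a b : V) : V := N (deformed a b) - br (N a) (N b).

Let S0 a : S a -> S 0.
Proof. by move=> Sa; rewrite -(subrr a); apply: SD => //; exact: SN. Qed.

Lemma br_opp a c : S a -> S c -> br (- a) c = - br a c.
Proof.
move=> Sa Sc; have Sna := SN Sa; have S00 := S0 Sa.
have br0 : br 0 c = 0.
  by have /eqP := brD S00 S00 Sc; rewrite addr0 addrC -subr_eq subrr => /eqP.
by apply/eqP; rewrite -addr_eq0 -brD // addNr br0.
Qed.

Lemma N_opp a : S a -> N (- a) = - N a.
Proof.
move=> Sa; have Sna := SN Sa; have S00 := S0 Sa.
have N0 : N 0 = 0.
  by have /eqP := ND S00 S00; rewrite addr0 addrC -subr_eq subrr => /eqP.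
by apply/eqP; rewrite -addr_eq0 -ND // addNr N0.
Qed.

Lemma mem_deformed a b : S a -> S b -> S (deformed a b).
Proof. by move=> Sa Sb; rewrite /deformed; auto 7. Qed.

Lemma br_deformed a b c : S a -> S b -> S c ->
  br (deformed a b) c = br (br (N a) b) c + br (br a (N b)) c - br (N (br a b)) c.
Proof. by move=> *; rewrite /deformed !brD ?br_opp; auto 7. Qed.

Let N_sum3 a b c : S a -> S b -> S c -> N (a + b + c) = N a + N b + N c.
Proof. by move=> *; rewrite !ND; auto. Qed.

(* The deformed bracket is the coboundary of [N] in the Lie algebra complex. *)
Lemma deformed_cocycle a b c : S a -> S b -> S c ->
  br (deformed a b) c + deformed (br a b) c
  + (br (deformed b c) a + deformed (br b c) a)
  + (br (deformed c a) b + deformed (br c a) b) = 0.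
Proof.
move=> Sa Sb Sc; rewrite !br_deformed // /deformed.
have j1 := jacobi (SNij Sa) Sb Sc; have j2 := jacobi Sa (SNij Sb) Sc.
have j3 := jacobi Sa Sb (SNij Sc).
have := congr1 N (jacobi Sa Sb Sc).
have -> : N 0 = 0 by rewrite -(subrr a) ND ?N_opp ?subrr; auto.
rewrite N_sum3; auto => j4.
transitivity ((br (br (N a) b) c + br (br b c) (N a) + br (br c (N a)) b)
  + (br (br a (N b)) c + br (br (N b) c) a + br (br c a) (N b))
  + (br (br a b) (N c) + br (br b (N c)) a + br (br (N c) a) b)
  - (N (br (br a b) c) + N (br (br b c) a) + N (br (br c a) b))).
  zmod.
by rewrite j1 j2 j3 j4 !addr0 subrr.
Qed.

(* For the Nijenhuis-Richardson bracket, [mu, mu] = 0 gives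
   [[mu, N], [mu, N]] = [mu, [[mu, N], N]] up to sign, and [[mu, N], N] is twice
   the torsion. *)
Lemma deformed_jacobiator a b c : S a -> S b -> S c ->
  deformed (deformed a b) c + deformed (deformed b c) a
  + deformed (deformed c a) b =
  br (nijenhuis a b) c + nijenhuis (br a b) c
  + (br (nijenhuis b c) a + nijenhuis (br b c) a)
  + (br (nijenhuis c a) b + nijenhuis (br c a) b).
Proof.
move=> Sa Sb Sc.
have Sd := mem_deformed.
have j1 := jacobi (SNij Sa) (SNij Sb) Sc; have j2 := jacobi Sa (SNij Sb) (SNij Sc).
have j3 := jacobi (SNij Sa) Sb (SNij Sc).
have brT x y z : S x -> S y -> S z ->
    br (nijenhuis x y) z = br (N (deformed x y)) z - br (br (N x) (N y)) z.
  by move=> *; rewrite /nijenhuis brD ?br_opp; auto 7.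
have := congr1 N (deformed_cocycle Sa Sb Sc).
have -> : N 0 = 0 by rewrite -(subrr a) ND ?N_opp ?subrr; auto.
have N2 x y z : S x -> S y -> S z -> N (br (deformed x y) z + deformed (br x y) z) =
    N (br (deformed x y) z) + N (deformed (br x y) z) by move=> *; apply: ND; auto.
rewrite N_sum3 ?N2 //; [|by auto..] => j4.
have defE x y z : S x -> S y -> S z -> deformed (deformed x y) z =
    br (N (deformed x y)) z
    + (br (br (N x) y) (N z) + br (br x (N y)) (N z) - br (N (br x y)) (N z))
    - N (br (deformed x y) z).
  by move=> *; rewrite {1}/deformed br_deformed; auto.
rewrite !defE // !brT // /nijenhuis.
apply/eqP; rewrite -subr_eq0; apply/eqP.
(* Three Jacobi identities with [N] on two arguments, minus [N] applied to the cocycle identity. *)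
transitivity (
  (br (br (N a) (N b)) c + br (br (N b) c) (N a) + br (br c (N a)) (N b))
  + (br (br a (N b)) (N c) + br (br (N b) (N c)) a + br (br (N c) a) (N b))
  + (br (br (N a) b) (N c) + br (br b (N c)) (N a) + br (br (N c) (N a)) b)
  - (N (br (deformed a b) c) + N (deformed (br a b) c)
     + (N (br (deformed b c) a) + N (deformed (br b c) a))
     + (N (br (deformed c a) b) + N (deformed (br c a) b)))).
  zmod.
by rewrite j1 j2 j3 j4 !addr0 subrr.
Qed.

End NijenhuisTorsion.

(** * Lifted Dirac structures *)

Section LiftedDirac.
Variables (R : realType) (M : manifold R) (E : vbundle M).
Hypothesis rankE_gt0 : (0 < vrank E)%N.
Variables (k : nat) (A : set (TE E)) (br : TE E -> TE E -> TE E).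
Hypothesis hA : projective_lie_algebroid k A br.
Local Notation C := (Cinf M).
Local Notation omni := (omni E).
Local Notation TE := (TE E).
Implicit Types (X Y Z W h l : omni) (a b c s t : TE).

Lemma A_lin (f : C) a b : A a -> A b -> A (f *: a + b).
Proof. by have [[_ h _ _] _ _ _ _ _] := hA; exact: h. Qed.

Lemma A0 : A 0. Proof. by have [[h _ _ _] _ _ _ _ _] := hA. Qed.

Lemma AZ (f : C) a : A a -> A (f *: a).
Proof. by move=> Aa; rewrite -[_ *: _]addr0; exact: A_lin A0. Qed.

Lemma AD a b : A a -> A b -> A (a + b).
Proof. by move=> Aa Ab; rewrite -[a]scale1r; exact: A_lin. Qed.

Lemma AN a : A a -> A (- a).
Proof. by move=> Aa; rewrite -scaleN1r; exact: AZ. Qed.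

Lemma Abr a b : A a -> A b -> A (br a b).
Proof. by have [_ h _ _ _ _] := hA; exact: h. Qed.

Lemma br_addl a b c : A a -> A b -> A c -> br (a + b) c = br a c + br b c.
Proof.
move=> Aa Ab Ac; have [_ _ h _ _ _] := hA; have := h 1 a b c Aa Ab Ac.
by rewrite !scale1r.
Qed.

Lemma br_skew a b : A a -> A b -> br b a = - br a b.
Proof. by have [_ _ _ h _ _] := hA; exact: h. Qed.

Lemma br_jacobi a b c : A a -> A b -> A c ->
  br (br a b) c + br (br b c) a + br (br c a) b = 0.
Proof. by have [_ _ _ _ h _] := hA; exact: h. Qed.

Lemma br_leibniz (f : C) a b : A a -> A b ->
  br a (f *: b) = f *: br a b + a.1 f *: b.
Proof. by have [_ _ _ _ _ h] := hA; exact: h. Qed.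

Lemma br_leibnizl (f : C) a b : A a -> A b ->
  br (f *: a) b = f *: br a b - b.1 f *: a.
Proof.
move=> Aa Ab; rewrite (br_skew Ab (AZ f Aa)) br_leibniz // (br_skew Aa Ab).
by rewrite opprD scalerN opprK.
Qed.

(** Multiplication by a function that is nonzero at x plays the part of restriction to a
    neighbourhood of x. *)
Lemma TE_local_eq s t :
  (forall x, exists2 Del : C, Del x != 0 & Del *: s = Del *: t) -> s = t.
Proof.
move=> loc; apply/eqP; rewrite -subr_eq0; apply/eqP; apply: van_TE_eq0 => x.
have [Del D0 e] := loc x; have {}e : Del *: (s - t) = 0 by rewrite scalerBr e subrr.
split=> [f|].
  have := congr1 (fun t : TE => t.1 f x) e => /eqP.
  by rewrite /= mulf_eq0 (negbTE D0) => /eqP.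
have := congr1 (fun t : TE => t.2 x) e => /eqP.
by rewrite /= scaler_eq0 (negbTE D0) => /eqP.
Qed.

(** * Orthogonality of A^0 and b^-1(A) *)

Lemma pairing_gl_hom (phi : DE E) (y : HomTE E) Z : dsym phi = 0 ->
  pairing (phi, jet_hom y) Z + pairing (phi, jet_hom y) Z =
  phi (bmap Z).2 + y (bmap Z).1.
Proof. by move=> p0; rewrite pairing_double /= [Z.2 phi]jet_gl. Qed.

Lemma annihilator_pairing h Z : annihilator A h -> A (bmap Z) -> pairing h Z = 0.
Proof.
move=> [phi [y [p0 -> hA0]]] AZ0; apply: double_inj.
by rewrite pairing_gl_hom // hA0 // addr0.
Qed.

Lemma annihilator_bmap h : annihilator A h -> bmap h = 0.
Proof.
by move=> [phi [y [p0 -> _]]]; congr pair => //; exact: hom0.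
Qed.

Lemma bpreimage_perp Z :
  (forall h, annihilator A h -> pairing h Z = 0) -> A (bmap Z).
Proof.
move=> perpZ; have [sA _ _ _ _ _] := hA.
apply: (mem_of_annihilators rankE_gt0 sA) => phi y p0 ann.
rewrite -pairing_gl_hom // perpZ ?addr0 //.
by exists phi, y.
Qed.

(** Elements of ker b serve as tests: the identity operator gives p(W.2) = 0, and df (x) e gives the
    vanishing of the symbol of [W.1]. So [W] lies in Hom(TM (+) E, E), and pairing it with lifts of
    sections of [A] shows that it kills [A]. *)
Lemma annihilator_perp W :
  (forall Z, A (bmap Z) -> pairing W Z = 0) -> annihilator A W.
Proof.
move=> perpW.
have double0 Z : A (bmap Z) -> Z.2 W.1 + W.2 Z.1 = 0.
  by move=> AZ0; rewrite -pairing_double perpW // addr0.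
have W20 : W.2 (id_de E) = 0.
  have := double0 (id_de E, 0); rewrite /= add0r; apply.
  exact: A0.
have W10 : dsym W.1 = 0.
  apply: vf_ext => f; apply: cf_ext => x.
  have [e e0] := section_nonvanishing x rankE_gt0.
  have := double0 (0, jet_hom (df_tensor f e)).
  rewrite /= jet0 addr0 => h; have {}h : dsym W.1 f *: e = 0.
    have b0 : bmap (0, jet_hom (df_tensor f e)) = 0.
      by congr pair; exact: (hom0 (df_tensor f e)).
    by apply: h; rewrite b0; exact: A0.
  have /eqP := congr1 (fun s : Sec E => s x) h.
  by rewrite /= scaler_eq0 => /orP[/eqP //|/eqP].
(* The chosen lifts of vector fields need not be linear, but [W.2] sees only the symbol because it
   kills gl(E). *)
have [g gE] := choice (@dsym_surjective R M E).
have W2ker d r : dsym d = dsym r -> W.2 d = W.2 r.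
  move=> dr; rewrite -[d](subrK r) jetD jet_gl ?W20 ?dop0 ?add0r //=.
  by rewrite dr scaleN1r subrr.
have y_lin (f : C) (U V : VF M) :
    W.2 (g (f *: U + V)) = f *: W.2 (g U) + W.2 (g V).
  by rewrite -jet_lin; apply: W2ker; rewrite /= !gE.
pose y := MkHomTE y_lin.
have WE : W = (W.1, jet_hom y).
  rewrite [LHS]surjective_pairing; congr pair; apply: jet_ext => d.
  by apply: W2ker; rewrite gE.
exists W.1, y; split=> // a Aa; have [Z Za] := bmap_surjective a.
by rewrite -Za -pairing_gl_hom // -WE perpW ?Za // addr0.
Qed.

Lemma normalizer_annihilator :
  normalizer (annihilator A) = normalizer (bpreimage A).
Proof.
apply/seteqP; split=> X NX.
  move=> Z AZ0; apply: bpreimage_perp => h hA0.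
  have := pairing_invariant X h Z; rewrite annihilator_pairing // dop0.
  by rewrite [pairing (dorfman _ _) _]annihilator_pairing ?add0r //; exact: NX.
move=> h hA0; apply: annihilator_perp => Z AZ0.
have := pairing_invariant X h Z; rewrite annihilator_pairing // dop0.
by rewrite [pairing h (dorfman _ _)]annihilator_pairing ?addr0 //; exact: NX.
Qed.

(** * Skew bilinear maps on A *)

Definition bilinear_skew (F : TE -> TE -> TE) :=
  (forall (f : C) a b c, A a -> A b -> A c ->
     F (f *: a + b) c = f *: F a c + F b c) /\
  (forall a b, A a -> A b -> F b a = - F a b).

Lemma bilinear_skew0l F b : bilinear_skew F -> A b -> F 0 b = 0.
Proof.
move=> [Fl _] Ab; have /eqP := Fl 1 0 0 b A0 A0 Ab.
by rewrite !scale1r addr0 -subr_eq subrr eq_sym => /eqP.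
Qed.

Lemma bilinear_skewZZ F (f g : C) a b : bilinear_skew F -> A a -> A b ->
  F (f *: a) (g *: b) = (f * g) *: F a b.
Proof.
move=> bF Aa Ab; have [Fl Fs] := bF.
have Zl (u : C) a' b' : A a' -> A b' -> F (u *: a') b' = u *: F a' b'.
  move=> Aa' Ab'; rewrite -[u *: a']addr0 Fl //; last exact: A0.
  by rewrite bilinear_skew0l // addr0.
rewrite Zl //; last exact: AZ.
rewrite (Fs (g *: b)) //; last exact: AZ.
by rewrite Zl // -scalerN -Fs // scalerA.
Qed.

Variable LA : set omni.
Hypothesis hLA : lifted_dirac A br LA.

(** * Sections of the lifted Dirac structure *)

Lemma LA_perp : LA = perp LA. Proof. by have [[]] := hLA. Qed.

Lemma LA_lin (f : C) X Y : LA X -> LA Y -> LA (f *: X + Y).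
Proof. by have [[[m [_ h _ _]] _ _] _ _ _] := hLA; exact: h. Qed.

Lemma LA0 : LA 0.
Proof. by have [[[m [h _ _ _]] _ _] _ _ _] := hLA. Qed.

Lemma LA_bmap l : LA l -> A (bmap l).
Proof.
have [_ _ <- _] := hLA => Ll x; exists (bmap l); first by exists l.
by rewrite /same_value subrr; exact: van_TE0.
Qed.

Lemma LA_bracket l1 l2 : LA l1 -> LA l2 ->
  br (bmap l1) (bmap l2) = bmap (dorfman l1 l2).
Proof. by have [_ _ _ h] := hLA => ? ?; rewrite h. Qed.

Lemma local_section (x : M) : exists2 Del : C, Del x != 0 &
  forall a, A a -> exists2 l, LA l & bmap l = Del *: a.
Proof.
have [sA _ _ _ _ _] := hA.
apply: (@local_lift R M E A [set bmap l | l in LA] k x sA).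
- by exists 0; [exact: LA0|].
- move=> f s t [l Ll <-] [l' Ll' <-].
  by exists (f *: l + l'); [exact: LA_lin|].
- by move=> s [l Ll <-]; exact: LA_bmap.
- by move=> a y Aa; have [_ _ bL _] := hLA; rewrite -bL in Aa; exact: Aa.
Qed.

(** After multiplication by [Del] both arguments lift to L, and bilinearity extracts the factor
    [Del]^2. *)
Lemma bilinear_skew_eq F G : bilinear_skew F -> bilinear_skew G ->
  (forall l1 l2, LA l1 -> LA l2 ->
     F (bmap l1) (bmap l2) = G (bmap l1) (bmap l2)) ->
  forall a b, A a -> A b -> F a b = G a b.
Proof.
move=> bF bG FG a b Aa Ab; apply: TE_local_eq => x.
have [Del D0 lift] := local_section x.
have [l1 L1 e1] := lift a Aa; have [l2 L2 e2] := lift b Ab.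
exists (Del * Del); first by rewrite /= mulf_neq0.
by rewrite -!bilinear_skewZZ // -e1 -e2 FG.
Qed.

Lemma annihilator_LA h : annihilator A h -> LA h.
Proof.
move=> hA0; rewrite LA_perp => l Ll; apply: annihilator_pairing => //.
exact: LA_bmap.
Qed.

(** For Z in b^-1(A), [Del] Z is an element of L plus an element of ker b. Both L and ker b are
    isotropic and contain [l], so (l, Z) = 0. *)
Lemma LA_ker_annihilator l : LA l -> bmap l = 0 -> annihilator A l.
Proof.
move=> Ll bl0; apply: annihilator_perp => Z AZ0; apply: sec_ext => x.
have [Del D0 lift] := local_section x; have [l' Ll' e] := lift _ AZ0.
have ker0 K : bmap K = 0 -> pairing l K = 0.
  move=> [K1 K2]; have [l1 l2] := bl0; apply: double_inj.
  rewrite pairing_double addr0 [K.2 _]jet_gl // [l.2 _]jet_gl //.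
  rewrite [K.2 _]K2 [l.2 _]l2 !dop0.
  by rewrite addr0.
have /eqP : (Del *: pairing l Z) x = 0.
  rewrite -pairingZr -(subrK l' (Del *: Z)) pairingDr ker0 ?add0r.
    by rewrite LA_perp in Ll; rewrite Ll.
  by rewrite bmapD bmapN bmapZ e subrr.
by rewrite /= scaler_eq0 (negbTE D0) => /eqP.
Qed.

(** Extends the compatibility of brackets from L to b^-1(A) in the second argument: both sides obey
    the same Leibniz rule, and [Del] b(Y) lifts to L. *)
Lemma br_LA_bmap l Y : LA l -> A (bmap Y) ->
  br (bmap l) (bmap Y) = bmap (dorfman l Y).
Proof.
move=> Ll AY; apply: TE_local_eq => x.
have [Del D0 lift] := local_section x; have [l' Ll' e] := lift _ AY.
exists Del => //; have := LA_bracket Ll Ll'.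
rewrite e br_leibniz //; last exact: LA_bmap.
rewrite (bmap_dorfman_congr l (Z := Del *: Y)) // bmap_dorfmanZ.
by move/addIr.
Qed.

Lemma br_bmap_LA l Y : LA l -> A (bmap Y) ->
  br (bmap Y) (bmap l) =
  bmap (dorfman Y l) - Defs.inE (pairing Y l + pairing Y l).
Proof.
move=> Ll AY; rewrite (br_skew (LA_bmap Ll) AY) br_LA_bmap //.
by rewrite bmap_dorfmanC opprD opprK.
Qed.

Lemma pullback_exact_normalizer Omega X : bundle_map A Omega ->
  pullback_exact LA Omega X -> normalizer (annihilator A) X.
Proof.
move=> [_ Ol Os] ex h hA0; have bh := annihilator_bmap hA0.
apply: LA_ker_annihilator; last exact: bmap_dorfman_ker.
rewrite LA_perp => l Ll; have := ex h l (annihilator_LA hA0) Ll.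
rewrite bh (bilinear_skew0l (conj Ol Os) (LA_bmap Ll)) coboundary_pairing.
move=> /(congr1 (fun t : TE => t.2)) /= /eqP.
by rewrite eq_sym oppr_eq0 => /eqP.
Qed.

(** * The operator X. for X normalizing b^-1(A) *)

Section Normalizing.
Variable X : omni.
Hypothesis NX : normalizer (bpreimage A) X.
Local Notation N := (falling X).
Local Notation P := (deformed br N).

Lemma A_falling a : A a -> A (N a).
Proof.
by have [Y <-] := bmap_surjective a => AY; rewrite falling_bmap; exact: NX.
Qed.

Lemma A_deformed a b : A a -> A b -> A (P a b).
Proof.
move=> *; apply: mem_deformed => //; [exact: AD|exact: AN|exact: Abr|].
exact: A_falling.
Qed.

(** The three brackets cancel by the Leibniz identity for X. Only the first one has its element of L
    on the right, and the symmetric part of that bracket remains. *)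
Lemma deformed_LA l1 l2 : LA l1 -> LA l2 -> P (bmap l1) (bmap l2) =
  - Defs.inE (pairing (dorfman X l1) l2 + pairing (dorfman X l1) l2).
Proof.
move=> L1 L2; have [A1 A2] := (LA_bmap L1, LA_bmap L2).
rewrite /deformed !falling_bmap br_bmap_LA ?br_LA_bmap //; try exact: NX.
rewrite falling_bmap (bmap_dorfman_jacobi X l1 l2); zmod.
Qed.

Lemma deformed_skew a b : A a -> A b -> P b a = - P a b.
Proof.
move=> Aa Ab; have [ANa ANb] := (A_falling Aa, A_falling Ab).
rewrite /deformed (br_skew Aa ANb) (br_skew ANa Ab) (br_skew Aa Ab) fallingN.
zmod.
Qed.

(** The terms that differentiate [f] cancel because the anchor of X.c is the commutator of the
    symbol of X with that of [c]. *)
Lemma deformedZ (f : C) a c : A a -> A c -> P (f *: a) c = f *: P a c.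
Proof.
move=> Aa Ac; have [ANa ANc] := (A_falling Aa, A_falling Ac).
rewrite /deformed fallingZ br_addl ?br_leibnizl //; try exact: AZ.
rewrite fallingD fallingN !fallingZ falling_anchor /= !scalerDr !scalerN.
rewrite scalerBl; zmod.
Qed.

Lemma deformedD a b c : A a -> A b -> A c -> P (a + b) c = P a c + P b c.
Proof.
move=> Aa Ab Ac.
have [ANa ANb ANc] := And3 (A_falling Aa) (A_falling Ab) (A_falling Ac).
rewrite /deformed fallingD !br_addl // fallingD; zmod.
Qed.

Lemma bilinear_skew_deformed : bilinear_skew P.
Proof.
split=> [f a b c Aa Ab Ac|]; last exact: deformed_skew.
by rewrite deformedD ?deformedZ //; exact: AZ.
Qed.

(** The deformed bracket and its E-component are both bilinear and skew, and they agree on b(L). *)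
Lemma deformed_in_E a b : A a -> A b -> (P a b).1 = 0.
Proof.
move=> Aa Ab; have [Pl Ps] := bilinear_skew_deformed.
rewrite (@bilinear_skew_eq P (fun a b => Defs.inE (P a b).2)) //.
  split=> [f a' b' c' ? ? ?|a' b' ? ?].
    by rewrite Pl // /Defs.inE; congr pair; rewrite /= ?scaler0 ?addr0.
  by rewrite Ps // /Defs.inE; congr pair; rewrite /= ?scaler0 ?oppr0.
move=> l1 l2 L1 L2; rewrite deformed_LA //.
by congr pair; rewrite /= ?scaler0 ?oppr0.
Qed.

Lemma half_double t : Defs.half M *: (t + t) = t.
Proof.
rewrite scalerDr -scalerDl (_ : Defs.half M + Defs.half M = 1) ?scale1r //.
by apply: cf_ext => x /=; field.
Qed.

Lemma TE_double_inj s t : s + s = t + t -> s = t.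
Proof. by move=> e; rewrite -(half_double s) e half_double. Qed.

Lemma half_deformed_LA l1 l2 : LA l1 -> LA l2 ->
  Defs.half M *: P (bmap l1) (bmap l2) =
  Defs.inE (coboundary (cochain X) l1 l2).
Proof.
move=> L1 L2; rewrite deformed_LA // coboundary_pairing.
set p := pairing _ _; apply: etrans (half_double _); congr (_ *: _).
by congr pair; rewrite /= ?scaler0 ?oppr0 ?addr0 // opprD.
Qed.

Lemma bilinear_skew_half : bilinear_skew (fun a b => Defs.half M *: P a b).
Proof.
have [Pl Ps] := bilinear_skew_deformed.
split=> [f a b c Aa Ab Ac|a b Aa Ab]; last by rewrite Ps // scalerN.
by rewrite Pl // scalerDr !scalerA mulrC.
Qed.

Lemma pullback_exact_formula Omega : bundle_map A Omega ->
  pullback_exact LA Omega X -> omega_formula A br Omega X.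
Proof.
move=> [_ Ol Os] ex; apply: (bilinear_skew_eq (conj Ol Os) bilinear_skew_half).
by move=> l1 l2 L1 L2; rewrite half_deformed_LA // ex.
Qed.

(** * Deformed brackets on A *)

Section Deformation.
Variable Omega : TE -> TE -> TE.
Hypotheses (bO : bundle_map A Omega) (OE : omega_formula A br Omega X).

Lemma A_Omega a b : A a -> A b -> A (Omega a b).
Proof. by have [h _ _] := bO => Aa Ab; have [] := h a b Aa Ab. Qed.

Lemma bilinear_skew_Omega : bilinear_skew Omega.
Proof. by have [_ Ol Os] := bO. Qed.

Lemma Omega_double a b : A a -> A b -> Omega a b + Omega a b = P a b.
Proof. by move=> Aa Ab; rewrite OE // -scalerDr half_double. Qed.

Lemma Omega_cocycle a b c : A a -> A b -> A c ->
  br (Omega a b) c + Omega (br a b) c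
  + (br (Omega b c) a + Omega (br b c) a)
  + (br (Omega c a) b + Omega (br c a) b) = 0.
Proof.
move=> Aa Ab Ac; apply: TE_double_inj; rewrite addr0.
rewrite -[RHS](@deformed_cocycle TE A br N AD AN Abr A_falling br_addl
  (fun a b _ _ => fallingD X a b) br_jacobi a b c) //.
rewrite -!Omega_double ?br_addl //; try (by [apply: A_Omega|apply: Abr]).
zmod.
Qed.

(** The factor 4 arises because the deformed bracket is twice [Omega] and is applied twice. *)
Lemma Omega_jacobiator a b c : A a -> A b -> A c ->
  (Omega (Omega a b) c + Omega (Omega b c) a + Omega (Omega c a) b) *+ 4 =
  br (torsion br X a b) c + torsion br X (br a b) c
  + (br (torsion br X b c) a + torsion br X (br b c) a)
  + (br (torsion br X c a) b + torsion br X (br c a) b).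
Proof.
move=> Aa Ab Ac.
rewrite -[RHS](@deformed_jacobiator TE A br N AD AN Abr A_falling br_addl
  (fun a b _ _ => fallingD X a b) br_jacobi a b c) //.
have PP x y z : A x -> A y -> A z -> P (P x y) z =
    Omega (Omega x y) z + Omega (Omega x y) z
    + (Omega (Omega x y) z + Omega (Omega x y) z).
  move=> Ax Ay Az; have AO := A_Omega Ax Ay.
  by rewrite -(Omega_double Ax Ay) deformedD // !Omega_double.
rewrite !PP // !mulrS mulr0n; zmod.
Qed.

(** By degree in epsilon: degree 0 is the Jacobi identity of [br], degree 1 is the cocycle identity,
    and only degree 2 survives. *)
Lemma deformation_jacobiator (e : R) a b c : A a -> A b -> A c ->
  let br' x y := br x y + cst_cf M e *: Omega x y in
  br' (br' a b) c + br' (br' b c) a + br' (br' c a) b =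
  cst_cf M e *: (cst_cf M e *:
    (Omega (Omega a b) c + Omega (Omega b c) a + Omega (Omega c a) b)).
Proof.
move=> Aa Ab Ac br'; rewrite {}/br'.
have [_ _ brl _ _ _] := hA; have [Ol _] := bilinear_skew_Omega.
have expand x y z : A x -> A y -> A z ->
    br (br x y + cst_cf M e *: Omega x y) z
      + cst_cf M e *: Omega (br x y + cst_cf M e *: Omega x y) z =
    br (br x y) z + cst_cf M e *: (br (Omega x y) z + Omega (br x y) z)
    + cst_cf M e *: (cst_cf M e *: Omega (Omega x y) z).
  move=> Ax Ay Az; have [AO Ab'] := (A_Omega Ax Ay, Abr Ax Ay).
  by rewrite ![br x y + _]addrC brl // Ol // !scalerDr; zmod.
rewrite !expand //.
have J := br_jacobi Aa Ab Ac.
have := congr1 (fun t => cst_cf M e *: t) (Omega_cocycle Aa Ab Ac).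
rewrite /= scaler0 !scalerDr => S1.
apply/eqP; rewrite -subr_eq0; apply/eqP; rewrite -[RHS]addr0 -{1}J -S1; zmod.
Qed.

Lemma generates_deformationP :
  generates_deformation k A br Omega <-> torsion_closed A br X.
Proof.
split=> [gen a b c Aa Ab Ac|tc e].
  (* The coefficient of epsilon^2 is read off at epsilon = 1. *)
  rewrite -Omega_jacobiator //; have [_ _ _ _ J _] := gen 1.
  have := J a b c Aa Ab Ac; rewrite deformation_jacobiator // !scale1r => ->.
  by rewrite mul0rn.
have [sA _ brl _ _ _] := hA; have [Ol Os] := bilinear_skew_Omega.
split=> //.
- by move=> a b Aa Ab; apply: AD; [exact: Abr|apply: AZ; exact: A_Omega].
- move=> r a b c Aa Ab Ac; rewrite /= brl // Ol // !scalerDr !scalerA mulrC; zmod.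
- by move=> a b Aa Ab; rewrite (br_skew Aa Ab) Os // scalerN opprD.
- move=> a b c Aa Ab Ac; rewrite deformation_jacobiator //.
  have := Omega_jacobiator Aa Ab Ac; rewrite tc // => Q0.
  set Q := _ + _ + _ in Q0 *; have -> : Q = 0; last by rewrite !scaler0.
  (* The factor 4 is removed by halving twice. *)
  apply: TE_double_inj; apply: TE_double_inj; rewrite !addr0 -Q0 !mulrS mulr0n.
  zmod.
- move=> f a b Aa Ab; rewrite br_leibniz //.
  have := bilinear_skewZZ 1 f bilinear_skew_Omega Aa Ab.
  rewrite scale1r mul1r => ->; rewrite scalerDr !scalerA mulrC; zmod.
Qed.

End Deformation.

Lemma formula_bundle_map Omega :
  omega_formula A br Omega X -> bundle_map A Omega.
Proof.
move=> OE; have [Hl Hs] := bilinear_skew_half.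
split=> [a b Aa Ab|f a b c Aa Ab Ac|a b Aa Ab].
- rewrite OE //; split; first by apply: AZ; exact: A_deformed.
  have := congr1 (fun v => Defs.half M *: v) (deformed_in_E Aa Ab).
  by rewrite scaler0.
- by rewrite !OE //; [exact: Hl|exact: A_lin].
- by rewrite !OE //; exact: Hs.
Qed.

Lemma formula_pullback_exact Omega :
  omega_formula A br Omega X -> pullback_exact LA Omega X.
Proof.
move=> OE l1 l2 L1 L2; rewrite OE; try exact: LA_bmap.
exact: half_deformed_LA.
Qed.

End Normalizing.
End LiftedDirac.

Theorem proposition6p5 (R : realType) (M : manifold R) (E : vbundle M)
    (rankE_gt0 : (0 < vrank E)%N)
    (k : nat) (k_gt0 : (0 < k)%N) (A : set (TE E)) (br : TE E -> TE E -> TE E)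
    (hA : projective_lie_algebroid k A br)
    (LA : set (omni E)) (hLA : lifted_dirac A br LA) :
  normalizer (annihilator A) = normalizer (bpreimage A) /\
  (forall Omega : TE E -> TE E -> TE E, bundle_map A Omega ->
   forall X : omni E, pullback_exact LA Omega X ->
     [/\ normalizer (annihilator A) X,
         omega_formula A br Omega X &
         generates_deformation k A br Omega <-> torsion_closed A br X]) /\
  (forall X : omni E, normalizer (bpreimage A) X -> torsion_closed A br X ->
   forall Omega : TE E -> TE E -> TE E, omega_formula A br Omega X ->
     [/\ bundle_map A Omega,
         generates_deformation k A br Omega &
         pullback_exact LA Omega X]).
Proof.
have NE := normalizer_annihilator rankE_gt0 hA.
split; first exact: NE.
split=> [Om bO X ex|X NX tc Om OE].
  have NX := pullback_exact_normalizer rankE_gt0 hA hLA bO ex.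
  have NX' := NX; rewrite NE in NX'.
  have OE := pullback_exact_formula hA hLA NX' bO ex.
  by split=> //; exact: (generates_deformationP hA NX' bO OE).
have bO := formula_bundle_map hA hLA NX OE.
split=> //; first by apply/(generates_deformationP hA NX bO OE).
exact: (formula_pullback_exact hA hLA NX OE).
Qed.
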